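(* Let $X$ be a diffeological space and $G$ an abelian diffeological group. There is a natural bijection between the set of isomorphism classes of principal $G$-bundles on $X$ and the group of Čech cohomology classes $\check{H}^1(X,G)$. (Natural means: for every smooth map $\varphi\colon Y\to X$ of diffeological spaces, the bijections for $X$ and $Y$ intertwine pullback of principal bundles $P\mapsto \varphi^*P=P\times_X Y$ with the induced map $\varphi^*\colon\check{H}^1(X,G)\to\check{H}^1(Y,G)$.)
   Context: A diffeological space is a set $X$ with a set $\mathcal{D}_X$ of maps $p\colon U_p\to X$ (plots), $U_p$ an open subset of some Euclidean space (any dimension), such that: all constant maps are plots; a map $U\to X$ that is locally a plot is a plot; if $p\colon U\to X$ is a plot and $f\colon V\to U$ is smooth ($V$ Euclidean open) then $p\circ f$ is a plot. A map $\varphi\colon X\to Y$ is smooth if $\varphi\circ p\in\mathcal{D}_Y$ for all $p\in\mathcal{D}_X$; a diffeomorphism is a smooth bijection with smooth inverse. Products carry the diffeology of maps with all components plots; subsets carry the plots with image in the subset; quotients $X/\!\sim$ carry the maps that locally lift to plots of $X$; disjoint sums carry the maps that are locally plots of a summand; fiber products carry the subset diffeology of the product. A diffeological group is a group with a diffeology making multiplication and inversion smooth. Principal bundle: a (right) principal $G$-bundle over $X$ is a diffeological space $P$ with a smooth right action of $G$ and quotient map $\pi\colon P\to X$ for that action (i.e. $\pi$ induces a diffeomorphism $P/G\cong X$) such that the action map $P\times G\to P\times_X P$, $(p,g)\mapsto(p,p\cdot g)$, is a diffeomorphism. A map of principal $G$-bundles over $X$ is a smooth $G$-equivariant map commuting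 with the maps to $X$; an isomorphism is an invertible such map. Generating families: a generating family of $X$ is a family $\mathcal{Q}\subseteq\mathcal{D}_X$ such that for every plot $p$ there are an open cover $\{U_\alpha\}$ of $U_p$, plots $q_\alpha\colon V_\alpha\to X$ in $\mathcal{Q}$ and smooth maps $f_\alpha\colon U_\alpha\to V_\alpha$ with $p|_{U_\alpha}=q_\alpha\circ f_\alpha$. Its nebula is $\mathcal{N}(\mathcal{Q})=\coprod_{q\in\mathcal{Q}}U_q$ with evaluation map $\mathrm{ev}\colon\mathcal{N}(\mathcal{Q})\to X$, $u\in U_q\mapsto q(u)$. Put $\mathcal{N}(\mathcal{Q})_k=\{(x_0,\dots,x_k)\in\mathcal{N}(\mathcal{Q})^{k+1}\mid \mathrm{ev}(x_0)=\dots=\mathrm{ev}(x_k)\}$ for $k\ge0$, and let $d_i\colon\mathcal{N}(\mathcal{Q})_k\to\mathcal{N}(\mathcal{Q})_{k-1}$ drop the $i$-th entry ($0\le i\le k$). Čech cohomology with values in $G$ (i.e. in the sheaf $C^\infty(\cdot,G)$ of smooth $G$-valued functions): $\check{C}^k(\mathcal{Q},G)=C^\infty(\mathcal{N}(\mathcal{Q})_k,G)$, $\partial f=\sum_{i=0}^{k+1}(-1)^i f\circ d_i$, and $\check{H}^k(\mathcal{Q},G)$ is the cohomology of this complex. A refinement of $\mathcal{Q}=\{q_\alpha\colon U_\alpha\to X\}_{\alpha\in A}$ is a generating family $\mathcal{R}=\{r_\beta\colon V_\beta\to X\}_{\beta\in B}$ with a map $\varphi\colon B\to A$ such that for each $\beta$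 there is a smooth $f_\beta\colon V_\beta\to U_{\varphi(\beta)}$ with $q_{\varphi(\beta)}\circ f_\beta=r_\beta$; the map $f=\coprod f_\beta\colon\mathcal{N}(\mathcal{R})\to\mathcal{N}(\mathcal{Q})$ induces, by pullback along $(x_0,\dots,x_k)\mapsto(f(x_0),\dots,f(x_k))$, a map $\check f\colon\check{H}^k(\mathcal{Q},G)\to\check{H}^k(\mathcal{R},G)$. $\check{H}^k(X,G)$ is the directed colimit of the groups $\check{H}^k(\mathcal{Q},G)$ over generating families ordered by refinement, along the maps $\check f$. Induced map: for smooth $\varphi\colon Y\to X$ and a generating family $\mathcal{Q}$ of $X$, there are a generating family $\mathcal{R}$ of $Y$ and a smooth $\psi\colon\mathcal{N}(\mathcal{R})\to\mathcal{N}(\mathcal{Q})$ with $\mathrm{ev}\circ\psi=\varphi\circ\mathrm{ev}$; $\varphi^*\colon\check{H}^k(X,G)\to\check{H}^k(Y,G)$ sends the class of a cocycle $f$ to the class of $(y_0,\dots,y_k)\mapsto f(\psi(y_0),\dots,\psi(y_k))$. *)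

(* Defs.v *)
From HB Require Import structures.
From mathcomp Require Import all_boot all_order all_algebra.
From mathcomp Require Import all_classical all_reals topology normedtype landau derive.
Set Implicit Arguments.
Unset Strict Implicit.
Unset Printing Implicit Defensive.
Import Order.TTheory GRing.Theory Num.Theory.
Import numFieldNormedType.Exports.
Local Open Scope classical_set_scope.
Local Open Scope ring_scope.

Section Calculus.
Variable R : realType.

(* [f] is C^k on the open set [U]: Frechet differentiable at every point of
   [U], with every directional derivative [x |-> 'd f x v] again C^(k-1). *)
Fixpoint Cn_on (k : nat) n (V : normedModType R) (U : set 'rV[R]_n)
    (f : 'rV[R]_n -> V) : Prop :=
  if k is k'.+1 then
    (forall x, U x -> differentiable f x) /\
    (forall v : 'rV[R]_n, Cn_on k' U (fun x => 'd f x v))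
  else forall x, U x -> {for x, continuous f}.

Definition smooth_on n (V : normedModType R) (U : set 'rV[R]_n)
    (f : 'rV[R]_n -> V) : Prop := forall k, Cn_on k U f.

Lemma near_diff (V W : normedModType R) (f g : V -> W) (x : V) :
  {near x, f =1 g} -> differentiable f x ->
  differentiable g x /\ 'd g x = 'd f x :> (V -> W).
Proof.
move=> fg df.
have fgx : f x = g x := nbhs_singleton fg.
have gE : g \o shift x = cst (g x) + 'd f x +o_ 0 id.
  apply/eqaddoP => e e0.
  have /eqaddoP/(_ e e0) := diff_locally df.
  move=> H; near=> y.
  rewrite -fgx /=.
  have -> : (g \o shift x - (cst (f x) + 'd f x)) y =
            (f \o shift x - (cst (f x) + 'd f x)) y.
    rewrite !fctE /=; congr (_ - _); symmetry.
    by near: y; move: fg; rewrite (near_shift 0); apply: filterS => z /=; rewrite subr0.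
  by near: y.
have dE := diff_unique (diff_continuous df) gE.
split; last by rewrite dE.
by apply/diff_locallyP; rewrite dE; split => //; exact: diff_continuous.
Unshelve. all: by end_near. Qed.

Lemma Cn_on_eq k n (V : normedModType R) (U : set 'rV[R]_n)
    (f g : 'rV[R]_n -> V) :
  open U -> {in U, f =1 g} -> Cn_on k U f -> Cn_on k U g.
Proof.
move=> oU; have nU x : U x -> nbhs x U by move=> Ux; apply: open_nbhs_nbhs.
elim: k f g => [|k IH] f g fg /=.
  move=> fc x Ux; have Nfg : {near x, f =1 g}.
    by apply: filterS (nU _ Ux) => y Uy; apply: fg; rewrite inE.
  rewrite /prop_for /continuous_at.
  rewrite -(fg x) ?inE//; have h : f @ x --> f x := fc x Ux.
  exact: (cvg_trans (near_eq_cvg Nfg) h).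
move=> [df dd]; have N x : U x -> {near x, f =1 g}.
  by move=> Ux; apply: filterS (nU _ Ux) => y Uy; apply: fg; rewrite inE.
split=> [x Ux|v]; first by have [] := near_diff (N _ Ux) (df _ Ux).
apply: IH (dd v) => x; rewrite inE => Ux.
by have [_ ->] := near_diff (N _ Ux) (df _ Ux).
Qed.

Lemma Cn_onS k n (V : normedModType R) (U : set 'rV[R]_n)
    (f : 'rV[R]_n -> V) : Cn_on k.+1 U f -> Cn_on k U f.
Proof.
elim: k f => [|k IH] f [df dd]; last by split=> // v; apply: IH.
by move=> x Ux; apply: differentiable_continuous; apply: df.
Qed.

Lemma Cn_on_sub k n (V : normedModType R) (U U' : set 'rV[R]_n)
    (f : 'rV[R]_n -> V) : U' `<=` U -> Cn_on k U f -> Cn_on k U' f.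
Proof.
move=> sU; elim: k f => [|k IH] f /=; first by move=> H x /sU; apply: H.
by move=> [df dd]; split=> [x /sU|v]; [apply: df|apply: IH].
Qed.

Lemma Cn_on_cst k n (V : normedModType R) (U : set 'rV[R]_n) (c : V) :
  Cn_on k U (fun=> c).
Proof.
elim: k c => [|k IH] c /=; first by move=> x _; exact: cst_continuous.
split=> [x _|v]; first exact: differentiable_cst.
rewrite (_ : (fun x => _) = fun=> 0); first exact: IH.
by apply/funext => x; rewrite (diff_cst c).
Qed.

Lemma Cn_on_lin k n (V W : normedModType R) (U : set 'rV[R]_n)
    (L : {linear V -> W}) (f : 'rV[R]_n -> V) :
  open U -> continuous L -> Cn_on k U f -> Cn_on k U (L \o f).
Proof.
move=> oU cL; elim: k f => [|k IH] f /=.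
  by move=> cf x Ux; apply: continuous_comp; [apply: cf|apply: cL].
move=> [df dd]; have dL y : differentiable L y by apply: linear_differentiable.
split=> [x Ux|v]; first by apply: differentiable_comp => //; apply: df.
apply: (@Cn_on_eq _ _ _ _ (L \o (fun x => 'd f x v))) => //; last exact: IH.
move=> x; rewrite inE => Ux /=.
by rewrite (diff_comp (df _ Ux) (dL _)) /= diff_lin.
Qed.

Lemma Cn_on_add k n (V : normedModType R) (U : set 'rV[R]_n)
    (f g : 'rV[R]_n -> V) :
  open U -> Cn_on k U f -> Cn_on k U g -> Cn_on k U (fun x => f x + g x).
Proof.
move=> oU; elim: k f g => [|k IH] f g /=.
  by move=> cf cg x Ux; exact: (cvgD (cf x Ux) (cg x Ux)).
move=> [df ddf] [dg ddg].
split=> [x Ux|v]; first exact: (differentiableD (df x Ux) (dg x Ux)).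
apply: (@Cn_on_eq _ _ _ _ (fun x => 'd f x v + 'd g x v)) => //; last exact: IH.
move=> x; rewrite inE => Ux.
exact: (esym (congr1 (@^~ v) (diffD (df _ Ux) (dg _ Ux)))).
Qed.

Lemma Cn_on_sum k n (V : normedModType R) (U : set 'rV[R]_n) (I : Type)
    (s : seq I) (F : I -> 'rV[R]_n -> V) :
  open U -> (forall i, Cn_on k U (F i)) ->
  Cn_on k U (fun x => \sum_(i <- s) F i x).
Proof.
move=> oU cF; elim: s => [|i s IH].
  by under eq_fun do rewrite big_nil; apply: Cn_on_cst.
by under eq_fun do rewrite big_cons; apply: Cn_on_add.
Qed.

Lemma Cn_on_mul k n (U : set 'rV[R]_n) (f g : 'rV[R]_n -> R) :
  open U -> Cn_on k U f -> Cn_on k U g -> Cn_on k U (fun x => f x * g x).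
Proof.
move=> oU; elim: k f g => [|k IH] f g.
  by move=> /= cf cg x Ux; exact: (cvgM (cf x Ux) (cg x Ux)).
move=> Cf Cg; have [[df ddf] [dg ddg]] := (Cf, Cg).
split=> [x Ux|v]; first exact: (differentiableM (df x Ux) (dg x Ux)).
apply: (@Cn_on_eq _ _ _ _ (fun x => f x * 'd g x v + g x * 'd f x v)) => //.
  move=> x; rewrite inE => Ux.
  exact: (esym (congr1 (@^~ v) (diffM (df _ Ux) (dg _ Ux)))).
exact: (Cn_on_add oU (IH _ _ (Cn_onS Cf) (ddg v)) (IH _ _ (Cn_onS Cg) (ddf v))).
Qed.

Lemma Cn_on_coord k n m (U : set 'rV[R]_n) (f : 'rV[R]_n -> 'rV[R]_m) (j : 'I_m) :
  open U -> Cn_on k U f -> Cn_on k U (fun x => f x 0 j : R).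
Proof.
move=> oU Cf.
have lc : linear (fun N : 'rV[R]_m => N 0 j : R) by move=> a u v; rewrite !mxE.
pose lM := GRing.isLinear.Build _ _ _ _ _ lc.
pose L : {linear 'rV[R]_m -> R} := HB.pack (fun N : 'rV[R]_m => N 0 j : R) lM.
by apply: (@Cn_on_lin _ _ _ _ _ L) => //; apply: coord_continuous.
Qed.

Lemma Cn_on_scalel k n (V : normedModType R) (U : set 'rV[R]_n)
    (f : 'rV[R]_n -> R) (w : V) :
  open U -> Cn_on k U f -> Cn_on k U (fun x => f x *: w).
Proof.
move=> oU Cf.
have lc : linear ( *:%R ^~ w : R -> _) by move=> u y z; rewrite scalerDl scalerA.
pose lM := GRing.isLinear.Build _ _ _ _ _ lc.
pose L : {linear R -> V} := HB.pack ( *:%R ^~ w) lM.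
by apply: (@Cn_on_lin _ _ _ _ _ L) => //; apply: scalel_continuous.
Qed.

Lemma Cn_on_comp k n m p (U : set 'rV[R]_n) (U' : set 'rV[R]_m)
    (f : 'rV[R]_m -> 'rV[R]_p) (g : 'rV[R]_n -> 'rV[R]_m) :
  open U -> (forall x, U x -> U' (g x)) ->
  Cn_on k U' f -> Cn_on k U g -> Cn_on k U (f \o g).
Proof.
move=> oU; elim: k f g => [|k IH] f g gU.
  by move=> cf cg x Ux; apply: continuous_comp; [apply: cg|apply: cf; apply: gU].
move=> [df ddf] Cg; have [dg ddg] := Cg.
split=> [x Ux|v]; first exact: (differentiable_comp (dg x Ux) (df _ (gU _ Ux))).
apply: (@Cn_on_eq _ _ _ _ (fun x => \sum_(i < m) \sum_(j < p)
  (('d g x v) 0 i * ('d f (g x) (delta_mx 0 i : 'rV_m)) 0 j) *: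
    (delta_mx 0 j : 'rV[R]_p))) => //.
  move=> x; rewrite inE => Ux; rewrite (diff_comp (dg _ Ux) (df _ (gU _ Ux))) /=.
  rewrite [X in _ = 'd f _ X]row_sum_delta linear_sum.
  apply: eq_bigr => i _; rewrite linearZ /= [in RHS](row_sum_delta ('d f _ _)).
  by rewrite scaler_sumr; apply: eq_bigr => j _; rewrite scalerA.
apply: Cn_on_sum => // i; apply: Cn_on_sum => // j; apply: Cn_on_scalel => //.
apply: (Cn_on_mul oU); apply: (Cn_on_coord _ oU); first exact: (ddg v).
exact: (IH (fun y => 'd f y (delta_mx 0 i : 'rV_m)) g gU (ddf _) (Cn_onS Cg)).
Qed.

Lemma Cn_on_id k n (U : set 'rV[R]_n) : Cn_on k U (id : 'rV[R]_n -> 'rV[R]_n).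
Proof.
case: k => [|k]; first by move=> x _; apply: cvg_id.
split=> [x _|v]; first exact: ex_diff.
rewrite (_ : (fun x => _) = fun=> v); first exact: Cn_on_cst.
by apply/funext => x; rewrite diff_val.
Qed.

Lemma Cn_on_local k n (V : normedModType R) (U : set 'rV[R]_n)
    (f : 'rV[R]_n -> V) :
  (forall x, U x -> exists2 W : set 'rV[R]_n, W x & Cn_on k W f) ->
  Cn_on k U f.
Proof.
elim: k f => [|k IH] f /= H; first by move=> x /H [W Wx]; apply.
split=> [x /H [W Wx [dW _]]|v]; first exact: dW.
by apply: IH => x /H [W Wx [_ dW]]; exists W.
Qed.

End Calculus.

Lemma sval_inj (T : Type) (P : T -> Prop) : injective (@proj1_sig T P).
Proof. by move=> [x px] [y py] /= e; apply: eq_exist. Qed.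

(* Open subsets of Euclidean spaces, of any dimension including 0; the
   coercion [epoint] sends such a domain to its type of points. *)
Record edom (R : realType) := EDom {
  edim : nat;
  eset : set 'rV[R]_edim;
  eopen : open eset }.
Arguments eset {R} e.
Arguments eopen {R} e.

Definition epoint (R : realType) (D : edom R) : Type :=
  {x : 'rV[R]_(edim D) | eset D x}.
Coercion epoint : edom >-> Sortclass.

Section Domains.
Variable R : realType.
Implicit Types D E : edom R.

(* Only the values of the ambient extension [F] on the open set [eset D]
   matter, so this is ordinary smoothness between open sets. *)
Definition esmooth D E (f : D -> E) : Prop :=
  exists F : 'rV[R]_(edim D) -> 'rV[R]_(edim E),
    smooth_on (eset D) F /\ forall x : D, sval (f x) = F (sval x).

Definition esub D (W : set 'rV[R]_(edim D)) (oW : open W) : edom R :=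
  EDom (openI (eopen D) oW).

Definition einc D (W : set 'rV[R]_(edim D)) (oW : open W) (x : esub oW) : D :=
  exist (eset D) (sval x) (proj1 (svalP x)).

(* [Q] holds for the restrictions along the inclusions of the members of some
   open cover of [D], given by one neighbourhood [D `&` W] of each point. *)
Definition elocally D (Q : forall E, (E -> D) -> Prop) : Prop :=
  forall x : D, exists (W : set 'rV[R]_(edim D)) (oW : open W),
    W (sval x) /\ Q (esub oW) (@einc D W oW).

Definition estable D (Q : forall E, (E -> D) -> Prop) : Prop :=
  forall E E' (i : E -> D) (h : E' -> E), esmooth h -> Q E i -> Q E' (i \o h).

Lemma esmooth_id D : esmooth (@id D).
Proof. by exists id; split=> // k; apply: Cn_on_id. Qed.

Lemma esmooth_cst D E (y : E) : esmooth (fun _ : D => y).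
Proof. by exists (fun=> sval y); split=> // k; apply: Cn_on_cst. Qed.

Lemma esmooth_comp D E E' (f : E -> E') (g : D -> E) :
  esmooth f -> esmooth g -> esmooth (f \o g).
Proof.
move=> [F [sF fF]] [H [sH gH]]; exists (F \o H); split=> [k|x /=]; last first.
  by rewrite fF gH.
apply: (@Cn_on_comp _ _ _ _ _ _ (eset E)); [exact: eopen| |exact: sF|exact: sH].
by move=> x Ux; have <- := gH (exist _ x Ux); apply: svalP.
Qed.

Lemma esmooth_val n (U U' : set 'rV[R]_n) (oU : open U) (oU' : open U')
    (f : EDom oU -> EDom oU') :
  (forall x, sval (f x) = sval x) -> esmooth f.
Proof. by move=> fE; exists id; split=> // k; apply: Cn_on_id. Qed.

Lemma esmooth_inc D (W : set 'rV[R]_(edim D)) (oW : open W) :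
  esmooth (@einc D W oW).
Proof. by exists id; split=> // k; apply: Cn_on_id. Qed.

Lemma esmooth_local D E (f : D -> E) :
  elocally (fun E' (i : E' -> D) => esmooth (f \o i)) -> esmooth f.
Proof.
move=> fl; pose F (x : 'rV[R]_(edim D)) : 'rV[R]_(edim E) :=
  if pselect (eset D x) is left h then sval (f (exist _ x h)) else 0.
have FE (x : D) : sval (f x) = F (sval x).
  rewrite /F; case: pselect => [h|/(_ (svalP x))//].
  by congr (sval (f _)); apply: sval_inj.
exists F; split=> // k; apply: Cn_on_local => x Ux.
have [W [oW [/= Wx [H [sH fH]]]]] := fl (exist _ x Ux).
exists (eset D `&` W) => //.
apply: (Cn_on_eq (eopen (esub oW)) _ (sH k)).
move=> y; rewrite inE => UWy; have /= <- := fH (exist _ y UWy).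
by rewrite FE.
Qed.

Lemma esmooth_preimage D E (f : E -> D) (F : 'rV[R]_(edim E) -> 'rV[R]_(edim D))
    (W : set 'rV[R]_(edim D)) :
  smooth_on (eset E) F -> open W -> open (eset E `&` F @^-1` W).
Proof.
move=> sF oW; rewrite openE => x [Ux Wx]; apply: filterI.
  by apply: open_nbhs_nbhs; split => //; apply: eopen.
have cF : F @ x --> F x := sF 0%N x Ux.
by apply: cF; apply: open_nbhs_nbhs.
Qed.

Lemma elocally_pull D E (f : E -> D) (Q : forall E', (E' -> D) -> Prop) :
  estable Q -> esmooth f -> elocally Q ->
  elocally (fun E' (j : E' -> E) => Q E' (f \o j)).
Proof.
move=> sQ [F [sF fF]] lQ x; have [W [oW [Wx QW]]] := lQ (f x).
have oV := esmooth_preimage f sF oW.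
exists (eset E `&` F @^-1` W), oV; split.
  by split; [apply: svalP | rewrite /= -fF].
pose h0 (y : esub oV) := f (einc y).
have h0W y : (eset D `&` W) (sval (h0 y)).
  split; first exact: svalP.
  by rewrite /h0 fF /=; case: (svalP y) => _ [].
pose h (y : esub oV) : esub oW := exist _ (sval (h0 y)) (h0W y).
have -> : f \o einc (oW:=oV) = einc (oW:=oW) \o h.
  by apply/funext => y; apply: sval_inj.
apply: sQ QW; exists F; split=> [k|y]; last by rewrite /= /h0 fF.
by apply: Cn_on_sub (sF k) => y [].
Qed.

Lemma elocally_trans D (Q : forall E, (E -> D) -> Prop) :
  estable Q ->
  elocally (fun E (i : E -> D) =>
     elocally (fun E' (j : E' -> E) => Q E' (i \o j))) ->
  elocally Q.
Proof.
move=> sQ lQ x; have [W [oW [Wx lW]]] := lQ x.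
have [W' [oW' [W'x QW']]] := lW (exist _ (sval x) (conj (svalP x) Wx)).
exists (W `&` W'), (openI oW oW'); split=> //.
pose h (y : esub (openI oW oW')) : esub oW' :=
  exist (eset (esub oW')) (sval y)
    (conj (conj (proj1 (svalP y)) (proj1 (proj2 (svalP y))))
          (proj2 (proj2 (svalP y)))).
have -> : @einc D _ (openI oW oW') = einc (oW:=oW) \o einc (oW:=oW') \o h.
  by apply/funext => y; apply: sval_inj.
by apply: sQ QW'; apply: esmooth_val.
Qed.

Lemma elocally_all D (Q : forall E, (E -> D) -> Prop) :
  estable Q -> Q D id -> elocally Q.
Proof.
move=> sQ QD x; exists setT, openT; split=> //.
exact: (sQ _ _ id _ (esmooth_inc _) QD).
Qed.

Lemma elocally_mono D (Q Q' : forall E, (E -> D) -> Prop) :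
  (forall E i, Q E i -> Q' E i) -> elocally Q -> elocally Q'.
Proof. by move=> QQ lQ x; have [W [oW [Wx /QQ]]] := lQ x; exists W, oW. Qed.

Lemma elocally_and D (Q Q' : forall E, (E -> D) -> Prop) :
  estable Q -> estable Q' ->
  elocally Q -> elocally Q' -> elocally (fun E i => Q E i /\ Q' E i).
Proof.
move=> sQ sQ' lQ lQ' x; have [W [oW [Wx QW]]] := lQ x.
have [W' [oW' [W'x QW']]] := lQ' x.
exists (W `&` W'), (openI oW oW'); split=> //.
pose h (y : esub (openI oW oW')) : esub oW :=
  exist (eset (esub oW)) (sval y)
    (conj (proj1 (svalP y)) (proj1 (proj2 (svalP y)))).
pose h' (y : esub (openI oW oW')) : esub oW' :=
  exist (eset (esub oW')) (sval y)
    (conj (proj1 (svalP y)) (proj2 (proj2 (svalP y)))).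
split.
- have -> : @einc D _ (openI oW oW') = einc (oW:=oW) \o h.
    by apply/funext => y; apply: sval_inj.
  by apply: sQ QW; apply: esmooth_val.
- have -> : @einc D _ (openI oW oW') = einc (oW:=oW') \o h'.
    by apply/funext => y; apply: sval_inj.
  by apply: sQ' QW'; apply: esmooth_val.
Qed.

End Domains.

HB.mixin Record isDiffeological (R : realType) (X : Type) := {
  plot : forall D : edom R, (D -> X) -> Prop;
  plot_cst : forall (D : edom R) (x : X), plot D (fun=> x);
  plot_local : forall (D : edom R) (p : D -> X),
    elocally (fun E (i : E -> D) => plot E (p \o i)) -> plot D p;
  plot_comp : forall (D E : edom R) (p : D -> X) (f : E -> D),
    plot D p -> esmooth f -> plot E (p \o f) }.

#[short(type="diffType")]
HB.structure Definition Diffeological (R : realType) :=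
  {X of isDiffeological R X}.

Arguments plot {R X D} p : rename.
Arguments plot_cst {R X D} x : rename.
Arguments plot_local {R X D p} : rename.
Arguments plot_comp {R X D E p f} : rename.

Definition smooth (R : realType) (X Y : diffType R) (f : X -> Y) : Prop :=
  forall (D : edom R) (p : D -> X), plot p -> plot (f \o p).

Definition diffeomorphism (R : realType) (X Y : diffType R) (f : X -> Y) : Prop :=
  smooth f /\ exists g : Y -> X, [/\ smooth g, cancel f g & cancel g f].

Section SmoothTheory.
Variable R : realType.
Implicit Types X Y Z : diffType R.

Lemma smooth_id X : smooth (@id X). Proof. by []. Qed.

Lemma smooth_comp X Y Z (f : Y -> Z) (g : X -> Y) :
  smooth f -> smooth g -> smooth (f \o g).
Proof. by move=> sf sg D p pp; apply: (sf _ (g \o p)); apply: sg. Qed.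

Lemma estable_plot X (D : edom R) (p : D -> X) :
  estable (fun E (i : E -> D) => plot (p \o i)).
Proof. by move=> E E' i h sh pi; apply: (plot_comp pi sh). Qed.

Lemma plot_elocallyP X (D : edom R) (p : D -> X) :
  plot p -> elocally (fun E (i : E -> D) => plot (p \o i)).
Proof.
by move=> pp; apply: elocally_all => //; apply: estable_plot.
Qed.

End SmoothTheory.

Section EpointDiff.
Variables (R : realType) (D : edom R).

Fact epoint_plot_comp (E E' : edom R) (p : E -> D) (f : E' -> E) :
  esmooth p -> esmooth f -> esmooth (p \o f).
Proof. exact: esmooth_comp. Qed.

HB.instance Definition _ := isDiffeological.Build R (epoint D)
  (fun E y => esmooth_cst E y) (fun E p => @esmooth_local R E D p)
  epoint_plot_comp.
End EpointDiff.

Section ProdDiff.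
Variables (R : realType) (X Y : diffType R).

Definition prod_plot (D : edom R) (p : D -> X * Y) : Prop :=
  plot (fun u => (p u).1) /\ plot (fun u => (p u).2).

Fact prod_plot_cst (D : edom R) (x : X * Y) : prod_plot (fun _ : D => x).
Proof. by split; apply: plot_cst. Qed.

Fact prod_plot_local (D : edom R) (p : D -> X * Y) :
  elocally (fun E (i : E -> D) => prod_plot (p \o i)) -> prod_plot p.
Proof.
by move=> lp; split; apply: plot_local; apply: elocally_mono lp => E i [].
Qed.

Fact prod_plot_comp (D E : edom R) (p : D -> X * Y) (f : E -> D) :
  prod_plot p -> esmooth f -> prod_plot (p \o f).
Proof.
move=> [p1 p2] sf; split.
  exact: (plot_comp p1 sf).
exact: (plot_comp p2 sf).
Qed.

HB.instance Definition _ := isDiffeological.Build R (X * Y)%type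
  prod_plot_cst prod_plot_local prod_plot_comp.
End ProdDiff.

Section FunDiff.
Variables (R : realType) (I : Type) (X : diffType R).

Definition family_plot (D : edom R) (p : D -> I -> X) : Prop :=
  forall i, plot (p^~ i).

Fact family_plot_cst (D : edom R) (x : I -> X) : family_plot (fun _ : D => x).
Proof. by move=> i; apply: plot_cst. Qed.

Fact family_plot_local (D : edom R) (p : D -> I -> X) :
  elocally (fun E (i : E -> D) => family_plot (p \o i)) -> family_plot p.
Proof.
by move=> lp i; apply: plot_local; apply: elocally_mono lp => E j /(_ i).
Qed.

Fact family_plot_comp (D E : edom R) (p : D -> I -> X) (f : E -> D) :
  family_plot p -> esmooth f -> family_plot (p \o f).
Proof. by move=> pp sf i; apply: (plot_comp (pp i) sf). Qed.

HB.instance Definition _ := isDiffeological.Build R (I -> X)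
  family_plot_cst family_plot_local family_plot_comp.
End FunDiff.

Section SubDiff.
Variables (R : realType) (X : diffType R) (P : X -> Prop).

Definition sub_plot (D : edom R) (p : D -> {x : X | P x}) : Prop :=
  plot (fun u => sval (p u)).

Fact sub_plot_cst (D : edom R) x : sub_plot (fun _ : D => x).
Proof. exact: plot_cst. Qed.

Fact sub_plot_local (D : edom R) (p : D -> {x : X | P x}) :
  elocally (fun E (i : E -> D) => sub_plot (p \o i)) -> sub_plot p.
Proof. by move=> lp; apply: plot_local; apply: elocally_mono lp. Qed.

Fact sub_plot_comp (D E : edom R) (p : D -> {x : X | P x}) (f : E -> D) :
  sub_plot p -> esmooth f -> sub_plot (p \o f).
Proof. by move=> pp sf; apply: (plot_comp pp sf). Qed.

HB.instance Definition _ := isDiffeological.Build R {x : X | P x}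
  sub_plot_cst sub_plot_local sub_plot_comp.
End SubDiff.

Definition quotient (X : Type) (e : X -> X -> Prop) : Type :=
  {S : set X | exists x, S = [set y | e x y]}.

Definition qclass (X : Type) (e : X -> X -> Prop) (x : X) : quotient e :=
  exist _ [set y | e x y] (ex_intro _ x erefl).

Lemma qclass_surj (X : Type) (e : X -> X -> Prop) (c : quotient e) :
  exists x, c = qclass e x.
Proof. by case: c => S [x Sx]; exists x; apply: sval_inj. Qed.

Lemma qclassP (X : Type) (e : X -> X -> Prop) (x y : X) :
  (forall x, e x x) -> (forall x y, e x y -> e y x) ->
  (forall x y z, e x y -> e y z -> e x z) ->
  qclass e x = qclass e y <-> e x y.
Proof.
move=> er es et; split=> [/(congr1 sval)/= E|exy].
  have : [set z | e y z] y by apply: er.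
  by rewrite -E.
apply: sval_inj => /=; apply/seteqP; split=> z /=; last exact: et.
by apply: et; apply: es.
Qed.

Section QuotDiff.
Variables (R : realType) (X : diffType R) (e : X -> X -> Prop).

Definition quot_plot (D : edom R) (p : D -> quotient e) : Prop :=
  elocally (fun E (i : E -> D) =>
    exists2 l : E -> X, plot l & p \o i = qclass e \o l).

Fact quot_stable (D : edom R) (p : D -> quotient e) :
  estable (fun E (i : E -> D) =>
    exists2 l : E -> X, plot l & p \o i = qclass e \o l).
Proof.
move=> E E' i h sh [l pl pE]; exists (l \o h); first exact: plot_comp.
by rewrite compA pE.
Qed.

Fact quot_plot_cst (D : edom R) c : quot_plot (fun _ : D => c).
Proof.
have [x ->] := qclass_surj c; apply: elocally_all; first exact: quot_stable.
by exists (fun=> x) => //; apply: plot_cst.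
Qed.

Fact quot_plot_local (D : edom R) (p : D -> quotient e) :
  elocally (fun E (i : E -> D) => quot_plot (p \o i)) -> quot_plot p.
Proof. by move=> lp; apply: elocally_trans => //; apply: quot_stable. Qed.

Fact quot_plot_comp (D E : edom R) (p : D -> quotient e) (f : E -> D) :
  quot_plot p -> esmooth f -> quot_plot (p \o f).
Proof. by move=> pp sf; exact: (elocally_pull (@quot_stable _ p) sf pp). Qed.

HB.instance Definition _ := isDiffeological.Build R (quotient e)
  quot_plot_cst quot_plot_local quot_plot_comp.

Lemma smooth_qclass : smooth (qclass e).
Proof.
by move=> D p pp; apply: elocally_all; [apply: quot_stable|exists p].
Qed.
End QuotDiff.

Definition coproduct (R : realType) (I : Type) (T : I -> diffType R) : Type :=
  {i : I & T i}.

Section CoprodDiff.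
Variables (R : realType) (I : Type) (T : I -> diffType R).

Definition coprod_plot (D : edom R) (p : D -> coproduct T) : Prop :=
  elocally (fun E (j : E -> D) =>
    exists i : I, exists2 l : E -> T i, plot l & p \o j = existT T i \o l).

Fact coprod_stable (D : edom R) (p : D -> coproduct T) :
  estable (fun E (j : E -> D) =>
    exists i : I, exists2 l : E -> T i, plot l & p \o j = existT T i \o l).
Proof.
move=> E E' j h sh [i [l pl pE]]; exists i, (l \o h); first exact: plot_comp.
by rewrite compA pE.
Qed.

Fact coprod_plot_cst (D : edom R) c : coprod_plot (fun _ : D => c).
Proof.
case: c => i x; apply: elocally_all; first exact: coprod_stable.
by exists i, (fun=> x) => //; apply: plot_cst.
Qed.

Fact coprod_plot_local (D : edom R) (p : D -> coproduct T) :
  elocally (fun E (i : E -> D) => coprod_plot (p \o i)) -> coprod_plot p.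
Proof. by move=> lp; apply: elocally_trans => //; apply: coprod_stable. Qed.

Fact coprod_plot_comp (D E : edom R) (p : D -> coproduct T) (f : E -> D) :
  coprod_plot p -> esmooth f -> coprod_plot (p \o f).
Proof. by move=> pp sf; exact: (elocally_pull (@coprod_stable _ p) sf pp). Qed.

HB.instance Definition _ := isDiffeological.Build R (coproduct T)
  coprod_plot_cst coprod_plot_local coprod_plot_comp.
End CoprodDiff.

(* Abelian diffeological groups, written additively. *)
HB.mixin Record isDiffGroup (R : realType) G
    of GRing.Zmodule G & isDiffeological R G := {
  add_smooth : smooth (fun x : G * G => x.1 + x.2);
  opp_smooth : smooth (fun x : G => - x) }.

#[short(type="abDiffGroupType")]
HB.structure Definition AbDiffGroup (R : realType) :=
  {G of GRing.Zmodule G & Diffeological R G & isDiffGroup R G}.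

Section Bundles.
Variables (R : realType) (G : abDiffGroupType R).

Definition orbit_rel (P : Type) (act : P -> G -> P) (p q : P) : Prop :=
  exists g, q = act p g.

(* [pb_quotient] says that [pb_proj] induces a diffeomorphism from the orbit
   space [P / G], with its quotient diffeology, onto [X]. *)
Record principal_bundle (X : diffType R) := PrincipalBundle {
  pb_total :> diffType R;
  pb_act : pb_total -> G -> pb_total;
  pb_proj : pb_total -> X;
  pb_act0 : forall p, pb_act p 0 = p;
  pb_actD : forall p g h, pb_act p (g + h) = pb_act (pb_act p g) h;
  pb_act_smooth : smooth (fun z : pb_total * G => pb_act z.1 z.2);
  pb_proj_act : forall p g, pb_proj (pb_act p g) = pb_proj p;
  pb_quotient : exists h : quotient (orbit_rel pb_act) -> X,
    diffeomorphism h /\ forall p, h (qclass _ p) = pb_proj p;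
  pb_principal : diffeomorphism
    (fun z : pb_total * G =>
       exist (fun w : pb_total * pb_total => pb_proj w.1 = pb_proj w.2)
         (z.1, pb_act z.1 z.2) (esym (pb_proj_act z.1 z.2))) }.

Arguments pb_act {X} P p g : rename.
Arguments pb_proj {X} P p : rename.

Definition bundle_map (X : diffType R) (P P' : principal_bundle X)
    (f : P -> P') : Prop :=
  [/\ smooth f, (forall p g, f (pb_act P p g) = pb_act P' (f p) g) &
      (forall p, pb_proj P' (f p) = pb_proj P p)].

Definition bundle_iso (X : diffType R) (P P' : principal_bundle X) : Prop :=
  exists (f : P -> P') (g : P' -> P),
    [/\ bundle_map f, bundle_map g, cancel f g & cancel g f].

(* Isomorphism classes as predicates; [set] is not used because its universe
   is too small for the type of principal bundles. *)
Definition bundle_class (X : diffType R) : Type :=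
  {S : principal_bundle X -> Prop | exists P, S = bundle_iso P}.

Definition class_of_bundle (X : diffType R) (P : principal_bundle X) :
  bundle_class X := exist _ (bundle_iso P) (ex_intro _ P erefl).

Section BundleTheory.
Variables (X : diffType R) (P : principal_bundle X).

Lemma orbit_relP (p q : P) : orbit_rel (pb_act P) p q <-> pb_proj P p = pb_proj P q.
Proof.
split=> [[g ->]|e]; first by rewrite pb_proj_act.
have [_ [k [_ _ kK]]] := pb_principal P.
have /(congr1 sval)/= := kK (exist _ (p, q) e).
by move: (k _) => [p' g] [-> <-]; exists g.
Qed.

Lemma pb_proj_smooth : smooth (pb_proj P).
Proof.
have [h [[sh _] hE]] := pb_quotient P.
have -> : pb_proj P = h \o qclass _ by apply/funext => p; rewrite -hE.
exact: (smooth_comp sh (@smooth_qclass R P (orbit_rel (pb_act P)))).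
Qed.

Lemma pb_proj_surj x : exists p, pb_proj P p = x.
Proof.
have [h [[_ [k [_ _ kK]]] hE]] := pb_quotient P.
have [p pE] := qclass_surj (k x).
by exists p; rewrite -hE -pE kK.
Qed.

Lemma lift_stable (D : edom R) (r : D -> X) :
  estable (fun E (i : E -> D) =>
    exists2 l : E -> P, plot l & r \o i = pb_proj P \o l).
Proof.
move=> E E' i h sh [l pl lE]; exists (l \o h); first exact: plot_comp.
by rewrite compA lE.
Qed.

Lemma pb_proj_lift (D : edom R) (r : D -> X) : plot r ->
  elocally (fun E (i : E -> D) =>
    exists2 l : E -> P, plot l & r \o i = pb_proj P \o l).
Proof.
have [h [[_ [k [sk _ kK]]] hE]] := pb_quotient P => pr.
apply: elocally_mono (sk _ _ pr) => E i [l pl lE]; exists l => //.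
apply/funext => u /=; rewrite -hE; have /= <- := congr1 (@^~ u) lE.
by rewrite kK.
Qed.
End BundleTheory.

Section Pullback.
Variables (X Y : diffType R) (phi : Y -> X).
Hypothesis sphi : smooth phi.
Variable P : principal_bundle X.

Definition pull_total : diffType R := {z : P * Y | pb_proj P z.1 = phi z.2}.

Definition pull_act (z : pull_total) (g : G) : pull_total :=
  exist _ (pb_act P (sval z).1 g, (sval z).2)
    (etrans (pb_proj_act (sval z).1 g) (svalP z)).

Definition pull_proj (z : pull_total) : Y := (sval z).2.

Fact pull_act0 z : pull_act z 0 = z.
Proof. by apply: sval_inj; case: z => [[p y] e] /=; rewrite pb_act0. Qed.

Fact pull_actD z g h : pull_act z (g + h) = pull_act (pull_act z g) h.
Proof. by apply: sval_inj; rewrite /= pb_actD. Qed.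

Fact pull_act_smooth : smooth (fun z : pull_total * G => pull_act z.1 z.2).
Proof.
move=> D p [[p1 p2] p3]; split => //=.
exact: (@pb_act_smooth _ P D (fun u => ((sval (p u).1).1, (p u).2)) (conj p1 p3)).
Qed.

Fact pull_proj_act z g : pull_proj (pull_act z g) = pull_proj z.
Proof. by []. Qed.

Fact pull_orbit (z w : pull_total) : pull_proj z = pull_proj w ->
  orbit_rel pull_act z w.
Proof.
case: z w => [[p y] e] [[q y'] e']; rewrite /pull_proj /= => yy'.
have /orbit_relP[g gE] : pb_proj P p = pb_proj P q.
  by move: e e' => /= -> ->; rewrite yy'.
by exists g; apply: sval_inj; rewrite /= -gE yy'.
Qed.

Fact pull_quotient : exists h : quotient (orbit_rel pull_act) -> Y,
  diffeomorphism h /\ forall p, h (qclass _ p) = pull_proj p.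
Proof.
have rep (c : quotient (orbit_rel pull_act)) : exists z, c = qclass _ z.
  exact: qclass_surj.
pose h c := pull_proj (projT1 (cid (rep c))).
have er z : orbit_rel pull_act z z by apply: pull_orbit.
have hE z : h (qclass _ z) = pull_proj z.
  rewrite /h; case: cid => w /= /(congr1 sval)/= E.
  have : [set y | orbit_rel pull_act w y] w by apply: er.
  by rewrite -E => -[g ->].
exists h; split=> //; split.
  move=> D p pp; apply: plot_local; apply: elocally_mono pp => E i [l pl lE].
  have -> : h \o p \o i = (fun u => (sval (l u)).2).
    by apply/funext => u /=; have /= -> := congr1 (@^~ u) lE; rewrite hE.
  exact: pl.2.
have sec y : exists z : pull_total, pull_proj z = y.
  have [p pE] := pb_proj_surj P (phi y).
  by exists (exist _ (p, y) pE).
pose k y := qclass (orbit_rel pull_act) (projT1 (cid (sec y))).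
have kE z : k (pull_proj z) = qclass _ z.
  rewrite /k; case: cid => w /= /pull_orbit wz.
  apply: sval_inj => /=; apply/seteqP; split=> v [g ->]; apply: pull_orbit.
    by case: wz => g' ->; rewrite !pull_proj_act.
  by case: wz => g' ->; rewrite !pull_proj_act.
exists k; split.
- move=> D r pr.
  have lr := elocally_and (@lift_stable _ P _ _) (@estable_plot _ _ _ r)
    (pb_proj_lift P (sphi pr)) (plot_elocallyP pr).
  apply: elocally_mono lr => E i [[l pl lE] pri].
  have e u : pb_proj P (l u) = phi (r (i u)).
    by have /= -> := congr1 (@^~ u) lE.
  exists (fun u => exist _ (l u, r (i u)) (e u)); first by split.
  by apply/funext => u /=; rewrite -[r (i u)]/(pull_proj (exist _ (l u, r (i u)) (e u))) kE.
- by move=> c; have [z ->] := qclass_surj c; rewrite hE kE.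
- by move=> y; have [z <-] := sec y; rewrite kE hE.
Qed.

Fact pull_principal : diffeomorphism
  (fun z : pull_total * G =>
     exist (fun w : pull_total * pull_total => pull_proj w.1 = pull_proj w.2)
       (z.1, pull_act z.1 z.2) (esym (pull_proj_act z.1 z.2))).
Proof.
have [_ [k [sk hK kK]]] := pb_principal P.
pose F := {w : pull_total * pull_total | pull_proj w.1 = pull_proj w.2}.
have e (w : F) : pb_proj P (sval (sval w).1).1 = pb_proj P (sval (sval w).2).1.
  by case: w => -[[[p y] e] [[q y'] e']] /= yy'; move: yy'; rewrite /pull_proj /= e e' /= => ->.
pose c (w : F) : {w : P * P | pb_proj P w.1 = pb_proj P w.2} :=
  exist _ ((sval (sval w).1).1, (sval (sval w).2).1) (e w).
have kE p q (h : pb_proj P p = pb_proj P q) :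
    (k (exist _ (p, q) h)).1 = p /\ pb_act P p (k (exist _ (p, q) h)).2 = q.
  have /(congr1 sval)/= := kK (exist _ (p, q) h).
  by case: (k _) => p' g [/= -> ->].
split.
  move=> D p pp; split; first exact: pp.1.
  exact: (@pull_act_smooth D p pp).
exists (fun w => ((sval w).1, (k (c w)).2)); split.
- move=> D p pp; split; first exact: pp.1.
  have pcp : plot (c \o p) by split; [exact: pp.1.1|exact: pp.2.1].
  exact: (sk _ _ pcp).2.
- move=> [z g] /=; congr (_, _).
  set w := exist _ _ _.
  have -> : c w = exist _ ((sval z).1, pb_act P (sval z).1 g)
      (esym (pb_proj_act (sval z).1 g)) by apply: sval_inj.
  by have /= -> := hK ((sval z).1, g).
- move=> w; apply: sval_inj => /=; case: w => -[z z'] zz' /=.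
  congr (_, _); apply: sval_inj => /=.
  have [_ E] := kE _ _ (e (exist _ (z, z') zz')).
  rewrite E -[(sval z).2]/(pull_proj z) zz'.
  by rewrite /= /pull_proj; case: (sval z').
Qed.

Definition pullback_bundle : principal_bundle Y :=
  PrincipalBundle pull_act0 pull_actD pull_act_smooth pull_quotient
    pull_principal.

End Pullback.
End Bundles.

Section SmoothMaps.
Variables (R : realType) (X : diffType R) (G : abDiffGroupType R).

Definition smooth_pred : {pred X -> G} := fun f => `[< smooth f >].

Fact smooth_pred_zmod : zmod_closed smooth_pred.
Proof.
split=> [|f g /asboolP sf /asboolP sg]; apply/asboolP => D p pp.
  exact: (@plot_cst R G D 0).
have ng : smooth (fun x => - g x) by exact: (smooth_comp (@opp_smooth R G) sg).
exact: (@add_smooth R G D (fun u => (f (p u), - g (p u)))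
  (conj (sf _ _ pp) (ng _ _ pp))).
Qed.

HB.instance Definition _ :=
  GRing.isZmodClosed.Build (X -> G) smooth_pred smooth_pred_zmod.

Record smap := SMap { smap_fun :> X -> G; _ : smap_fun \in smooth_pred }.

HB.instance Definition _ := [isSub for smap_fun].
HB.instance Definition _ := [Choice of smap by <:].
HB.instance Definition _ := [SubChoice_isSubZmodule of smap by <:].

Lemma smap_smooth (f : smap) : smooth f.
Proof. by case: f => f fP; apply/asboolP. Qed.

Definition mk_smap (f : X -> G) (sf : smooth f) : smap := SMap (asboolT sf).

Lemma smapP (f g : smap) : f =1 g -> f = g.
Proof. by move=> fg; apply: val_inj; apply/funext. Qed.

Lemma smapD (f g : smap) x : (f + g) x = f x + g x. Proof. by []. Qed.
Lemma smapN (f : smap) x : (- f) x = - f x. Proof. by []. Qed.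
Lemma smapB (f g : smap) x : (f - g) x = f x - g x. Proof. by []. Qed.
Lemma smap0 x : (0 : smap) x = 0. Proof. by []. Qed.
Lemma smap_sum (I : Type) (r : seq I) (F : I -> smap) x :
  (\sum_(i <- r) F i) x = \sum_(i <- r) F i x.
Proof. by elim/big_rec2: _ => // i y z _ <-. Qed.
Lemma smapMz (f : smap) (n : int) x : (f *~ n) x = f x *~ n.
Proof.
have h m : (f *+ m) x = f x *+ m.
  by elim: m => [|m IH]; rewrite ?mulr0n// !mulrS smapD IH.
by case: n => n; rewrite ?NegzE ?mulrNz ?smapN -!pmulrn h.
Qed.
End SmoothMaps.

Section Nebula.
Variables (R : realType).
Implicit Types X Y : diffType R.

Record plot_of X := PlotOf {
  pdom :> edom R;
  pmap :> pdom -> X;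
  pmapP : plot pmap }.

Definition generating X (Q : set (plot_of X)) : Prop :=
  forall (D : edom R) (p : D -> X), plot p ->
    elocally (fun E (i : E -> D) =>
      exists2 q : plot_of X, Q q &
        exists2 f : E -> pdom q, esmooth f & p \o i = pmap (p:=q) \o f).

Record genfam X := GenFam {
  gf_set : set (plot_of X);
  gf_gen : generating gf_set }.

Definition gf_index X (Q : genfam X) : Type := {q : plot_of X | gf_set Q q}.

Definition gf_dom X (Q : genfam X) (a : gf_index Q) : edom R := pdom (sval a).

Definition nebula X (Q : genfam X) : diffType R :=
  coproduct (fun a : gf_index Q => (gf_dom a : diffType R)).

Definition ev X (Q : genfam X) (x : nebula Q) : X :=
  pmap (p := sval (projT1 x)) (projT2 x).

Definition same_ev X (Q : genfam X) (k : nat) (x : 'I_k.+1 -> nebula Q) : Prop :=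
  forall i j, ev (x i) = ev (x j).

Definition nebk X (Q : genfam X) (k : nat) : diffType R :=
  {x : 'I_k.+1 -> nebula Q | same_ev x}.

Definition nebk_face X (Q : genfam X) k (i : 'I_k.+2) (x : nebk Q k.+1) :
  nebk Q k :=
  exist (@same_ev X Q k) (fun j => sval x (lift i j)) (fun j j' => svalP x (lift i j) (lift i j')).

Lemma nebk_face_smooth X (Q : genfam X) k (i : 'I_k.+2) :
  smooth (@nebk_face X Q k i).
Proof. by move=> D p pp j; apply: pp. Qed.

(* Smooth maps of nebulas covering [phi]. *)
Record neb_map X Y (phi : Y -> X) (S : genfam Y) (Q : genfam X) := NebMap {
  nm_fun :> nebula S -> nebula Q;
  nm_smooth : smooth nm_fun;
  nm_ev : forall y, ev (nm_fun y) = phi (ev y) }.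

Fact nebk_map_subproof X Y (phi : Y -> X) S Q (psi : neb_map phi S Q) k
  (y : nebk S k) i j : ev (psi (sval y i)) = ev (psi (sval y j)).
Proof. by rewrite !nm_ev (svalP y i j). Qed.

Definition nebk_map X Y (phi : Y -> X) S Q (psi : neb_map phi S Q) k
    (y : nebk S k) : nebk Q k :=
  exist (@same_ev X Q k) (fun i => psi (sval y i)) (nebk_map_subproof psi y).

Lemma nebk_map_smooth X Y (phi : Y -> X) S Q (psi : neb_map phi S Q) k :
  smooth (@nebk_map X Y phi S Q psi k).
Proof. by move=> D p pp j; apply: (nm_smooth psi); apply: pp. Qed.

(* [refinement Q S]: [S] refines [Q], with the chosen maps of indices and of
   domains. *)
Record refinement X (Q S : genfam X) := Refinement {
  rf_index : gf_index S -> gf_index Q;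
  rf_map : forall b : gf_index S, gf_dom b -> gf_dom (rf_index b);
  rf_smooth : forall b, esmooth (@rf_map b);
  rf_ev : forall b (v : gf_dom b),
    pmap (p := sval (rf_index b)) (rf_map v) = pmap (p := sval b) v }.

Definition rf_neb_fun X (Q S : genfam X) (f : refinement Q S) (y : nebula S) :
  nebula Q :=
  existT _ (rf_index f (projT1 y)) (rf_map f (projT2 y)).

Fact rf_neb_smooth X (Q S : genfam X) (f : refinement Q S) : smooth (rf_neb_fun f).
Proof.
move=> D p pp; apply: elocally_mono pp => E i [b [l pl lE]].
exists (rf_index f b), (rf_map f (b:=b) \o l).
  by apply: esmooth_comp => //; apply: rf_smooth.
by apply/funext => u /=; have /= -> := congr1 (@^~ u) lE.
Qed.

Fact rf_neb_ev X (Q S : genfam X) (f : refinement Q S) y :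
  ev (rf_neb_fun f y) = id (ev y).
Proof. by case: y => b v; apply: rf_ev. Qed.

Definition rf_neb X (Q S : genfam X) (f : refinement Q S) : neb_map id S Q :=
  NebMap (rf_neb_smooth f) (rf_neb_ev f).

End Nebula.
Coercion rf_neb : refinement >-> neb_map.

Section Cech.
Local Open Scope quotient_scope.
Variables (R : realType) (G : abDiffGroupType R).
Implicit Types X Y : diffType R.

Section Complex.
Variables (X : diffType R) (Q : genfam X).

Definition cochain (k : nat) : zmodType := smap (nebk Q k) G.

Fact cobord_smooth k (f : cochain k) :
  smooth (fun x : nebk Q k.+1 => 
    \sum_(i < k.+2) f (nebk_face i x) *~ (-1) ^+ i).
Proof.
pose F (i : 'I_k.+2) : smap (nebk Q k.+1) G :=
  mk_smap (smooth_comp (smap_smooth f) (@nebk_face_smooth _ X Q k i)).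
have -> : (fun x => \sum_(i < k.+2) f (nebk_face i x) *~ (-1) ^+ i) =
  (\sum_(i < k.+2) F i *~ (-1) ^+ i : smap (nebk Q k.+1) G).
  by apply/funext => x; rewrite smap_sum; apply: eq_bigr => i _; rewrite smapMz.
exact: smap_smooth.
Qed.

Definition cobord k (f : cochain k) : cochain k.+1 := mk_smap (cobord_smooth f).

Lemma cobordE k (f : cochain k) x :
  cobord f x = \sum_(i < k.+2) f (nebk_face i x) *~ (-1) ^+ i.
Proof. by []. Qed.

Fact cobord_additive k : zmod_morphism (@cobord k).
Proof.
move=> f g; apply: smapP => x; rewrite smapB !cobordE -sumrB.
by apply: eq_bigr => i _; rewrite smapB mulrzBl.
Qed.

HB.instance Definition _ k :=
  GRing.isZmodMorphism.Build (cochain k) (cochain k.+1) (@cobord k)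
    (@cobord_additive k).

Definition cocycle_pred k : {pred cochain k} := fun f => cobord f == 0.

Fact cocycle_zmod k : zmod_closed (@cocycle_pred k).
Proof.
split=> [|f g /eqP cf /eqP cg]; apply/eqP; first by rewrite raddf0.
by rewrite raddfB /= cf cg subrr.
Qed.

HB.instance Definition _ k :=
  GRing.isZmodClosed.Build (cochain k) (@cocycle_pred k) (@cocycle_zmod k).

Record cocycle k := Cocycle { cocycle_val :> cochain k; _ : cocycle_val \in @cocycle_pred k }.

HB.instance Definition _ k := [isSub for @cocycle_val k].
HB.instance Definition _ k := [Choice of cocycle k by <:].
HB.instance Definition _ k := [SubChoice_isSubZmodule of cocycle k by <:].

Definition cocycle_fun k (z : cocycle k) : nebk Q k -> G :=
  smap_fun (cocycle_val z).

(* Degree 0 has no coboundaries but 0. *)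
Definition is_coboundary k : cochain k -> Prop :=
  if k is k'.+1 then fun f => exists h : cochain k', f = cobord h
  else fun f => f = 0.

Definition coboundary_pred k : {pred cocycle k} :=
  fun z => `[< is_coboundary (z : cochain k) >].

Fact coboundary_zmod k : zmod_closed (@coboundary_pred k).
Proof.
split=> [|f g /asboolP + /asboolP +]; first (apply/asboolP).
  by case: k => [|k] //=; exists 0; rewrite raddf0.
move=> bf bg; apply/asboolP; case: k f g bf bg => [|k] f g /=.
  by move=> -> ->; rewrite subrr.
by move=> [h ->] [h' ->]; exists (h - h'); rewrite raddfB.
Qed.

HB.instance Definition _ k :=
  GRing.isZmodClosed.Build (cocycle k) (@coboundary_pred k) (@coboundary_zmod k).

Definition cechHQ (k : nat) : zmodType := {ideal_quot (@coboundary_pred k)}.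

Definition cech_class k (z : cocycle k) : cechHQ k :=
  \pi_{ideal_quot (@coboundary_pred k)} z.

Definition cechHQ_repr k (c : cechHQ k) : cocycle k :=
  repr (c : {ideal_quot (@coboundary_pred k)}).

Lemma cechHQ_reprK k (c : cechHQ k) : cech_class (cechHQ_repr c) = c.
Proof. exact: (reprK (c : {ideal_quot (@coboundary_pred k)})). Qed.

Lemma cech_classD k (z w : cocycle k) :
  cech_class (z + w) = cech_class z + cech_class w.
Proof. exact: (raddfD \pi_{ideal_quot (@coboundary_pred k)}). Qed.

Lemma cech_classP k (z w : cocycle k) :
  cech_class z = cech_class w <->
  is_coboundary ((z : cochain k) - (w : cochain k)).
Proof.
split=> [/eqP|h].
  by rewrite -(@Quotient.idealrBE _ (@coboundary_pred k)) => /asboolP.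
apply/eqP; rewrite -(@Quotient.idealrBE _ (@coboundary_pred k)).
exact/asboolP.
Qed.

End Complex.
End Cech.
Coercion cocycle_fun : cocycle >-> Funclass.

Section CechPull.
Variables (R : realType) (G : abDiffGroupType R).
Implicit Types X Y Z : diffType R.

Section Pull.
Variables (X Y : diffType R) (phi : Y -> X) (S : genfam Y) (Q : genfam X).
Variable psi : neb_map phi S Q.

Definition cochain_pull k (f : cochain G Q k) : cochain G S k :=
  mk_smap (smooth_comp (smap_smooth f) (@nebk_map_smooth _ _ _ _ _ _ psi k)).

Fact cochain_pull_cobord k (f : cochain G Q k) :
  cochain_pull (cobord f) = cobord (cochain_pull f).
Proof.
apply: smapP => y; apply: eq_bigr => i _; congr (_ *~ _).
by congr (smap_fun f _); apply: sval_inj.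
Qed.

Fact cocycle_pull_subproof k (z : cocycle G Q k) :
  cochain_pull z \in @cocycle_pred R G Y S k.
Proof.
case: z => z zP; apply/eqP; rewrite -cochain_pull_cobord /= (eqP zP).
exact: smapP.
Qed.

Definition cocycle_pull k (z : cocycle G Q k) : cocycle G S k :=
  Cocycle (cocycle_pull_subproof z).

Definition cechHQ_pull k (c : cechHQ G Q k) : cechHQ G S k :=
  cech_class (cocycle_pull (cechHQ_repr c)).
End Pull.

Lemma cech_class_surj X (Q : genfam X) k (c : cechHQ G Q k) :
  exists z, c = cech_class z.
Proof. by exists (cechHQ_repr c); rewrite cechHQ_reprK. Qed.

Lemma cechHQ_pullE X Y (phi : Y -> X) S Q (psi : neb_map phi S Q) k
    (z : cocycle G Q k) :
  cechHQ_pull psi (cech_class z) = cech_class (cocycle_pull psi z).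
Proof.
rewrite /cechHQ_pull; apply/cech_classP.
have /cech_classP := cechHQ_reprK (cech_class z).
move: (cechHQ_repr _) => w; case: k z w => [|k] z w /=.
  move=> zw; apply: smapP => y; rewrite smapB /=.
  by have := congr1 (fun f : cochain G Q 0 => f (nebk_map psi y)) zw.
move=> [h hE]; exists (cochain_pull psi h); rewrite -cochain_pull_cobord -hE.
exact: smapP.
Qed.

Lemma cechHQ_pullD X Y (phi : Y -> X) S Q (psi : neb_map phi S Q) k
    (c d : cechHQ G Q k) :
  cechHQ_pull psi (c + d) = cechHQ_pull psi c + cechHQ_pull psi d.
Proof.
have [z ->] := cech_class_surj c; have [w ->] := cech_class_surj d.
rewrite -cech_classD !cechHQ_pullE -cech_classD; congr cech_class.
by apply: val_inj; apply: smapP.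
Qed.

Fact nm_comp_ev X Y Z (phi : Y -> X) (chi : Z -> Y) T S Q
  (psi : neb_map phi S Q) (psi' : neb_map chi T S) y :
  ev (psi (psi' y)) = (phi \o chi) (ev y).
Proof. by rewrite /= !nm_ev. Qed.

Definition nm_comp X Y Z (phi : Y -> X) (chi : Z -> Y) T S Q
    (psi : neb_map phi S Q) (psi' : neb_map chi T S) :
    neb_map (phi \o chi) T Q :=
  NebMap (smooth_comp (nm_smooth psi) (nm_smooth psi')) (nm_comp_ev psi psi').

Lemma cechHQ_pull_comp X Y Z (phi : Y -> X) (chi : Z -> Y) T S Q
    (psi : neb_map phi S Q) (psi' : neb_map chi T S) k (c : cechHQ G Q k) :
  cechHQ_pull (nm_comp psi psi') c = cechHQ_pull psi' (cechHQ_pull psi c).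
Proof.
have [z ->] := cech_class_surj c; rewrite !cechHQ_pullE; congr cech_class.
apply: val_inj; apply: smapP => y; congr (smap_fun (cocycle_val z) _).
exact: sval_inj.
Qed.

Section Homotopy.
Variables (X : diffType R) (Q : genfam X).

Fact mk1_subproof (a : nebula Q) : same_ev (fun _ : 'I_1 => a).
Proof. by []. Qed.
Definition mk1 a : nebk Q 0 := exist (@same_ev _ X Q 0) _ (mk1_subproof a).

Definition pair_fun (a b : nebula Q) (i : 'I_2) : nebula Q :=
  if val i is 0%N then a else b.
Fact mk2_subproof (a b : nebula Q) : ev a = ev b -> same_ev (pair_fun a b).
Proof. by move=> e [[|i] ?] [[|j] ?]. Qed.
Definition mk2 a b (e : ev a = ev b) : nebk Q 1 :=
  exist (@same_ev _ X Q 1) _ (mk2_subproof e).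

Definition trip_fun (a b c : nebula Q) (i : 'I_3) : nebula Q :=
  match val i with 0%N => a | 1%N => b | _ => c end.
Fact mk3_subproof (a b c : nebula Q) : ev a = ev b -> ev b = ev c ->
  same_ev (trip_fun a b c).
Proof.
by move=> e e' [[|[|i]] ?] [[|[|j]] ?]; rewrite /trip_fun //= ?e ?e'.
Qed.
Definition mk3 a b c (e : ev a = ev b) (e' : ev b = ev c) : nebk Q 2 :=
  exist (@same_ev _ X Q 2) _ (mk3_subproof e e').

Lemma nebk1E (x : nebk Q 1) a b (e : ev a = ev b) :
  sval x ord0 = a -> sval x ord_max = b -> x = mk2 e.
Proof.
move=> xa xb; apply: sval_inj; apply/funext => -[[|[|i]] li] //=.
  by rewrite -xa; congr (sval x _); apply: val_inj.
by rewrite -xb; congr (sval x _); apply: val_inj.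
Qed.

Lemma cocycle1P (z : cocycle G Q 1) a b c (e : ev a = ev b) (e' : ev b = ev c) :
  z (mk2 e) + z (mk2 e') = z (mk2 (etrans e e')).
Proof.
case: z => z zP /=; move: (congr1 (fun f : cochain G Q 2 => f (mk3 e e')) (eqP zP)).
rewrite cobordE !big_ord_recl big_ord0 smap0 addr0.
rewrite expr0 expr1 mulrNz expr2 mulrNN !mulr1z.
have -> : nebk_face ord0 (mk3 e e') = mk2 e' by apply: nebk1E.
have -> : nebk_face (lift ord0 ord0) (mk3 e e') = mk2 (etrans e e').
  exact: nebk1E.
have -> : nebk_face (lift ord0 (lift ord0 ord0)) (mk3 e e') = mk2 e.
  exact: nebk1E.
move=> h; apply/eqP; rewrite -subr_eq0; apply/eqP.
by rewrite -[RHS]h -addrA addrC -addrA.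
Qed.

Lemma cobord0E (h : cochain G Q 0) a b (e : ev a = ev b) :
  cobord h (mk2 e) = h (mk1 b) - h (mk1 a).
Proof.
rewrite cobordE !big_ord_recl big_ord0 addr0 expr0 expr1 mulrNz !mulr1z.
by congr (h _ - h _); apply: sval_inj; apply/funext => -[[|i] ?].
Qed.

Lemma nebk1_mk2 (x : nebk Q 1) : exists a b (e : ev a = ev b), x = mk2 e.
Proof.
exists (sval x ord0), (sval x ord_max), (svalP x ord0 ord_max).
exact: nebk1E.
Qed.
End Homotopy.

Lemma cechHQ_pull_homotopy X Y (phi : Y -> X) S Q (psi psi' : neb_map phi S Q)
    (c : cechHQ G Q 1) :
  cechHQ_pull psi c = cechHQ_pull psi' c.
Proof.
have [z ->] := cech_class_surj c; rewrite !cechHQ_pullE.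
apply/esym/cech_classP.
have ee y : ev (psi y) = ev (psi' y) by rewrite !nm_ev.
pose h0 (y : nebk S 0) := z (mk2 (ee (sval y ord0))).
have sh : smooth h0.
  move=> D p pp; apply: (smap_smooth z (p := fun u => mk2 (ee (sval (p u) ord0)))).
  move=> [[|i] ?].
    exact: (nm_smooth psi (pp ord0)).
  exact: (nm_smooth psi' (pp ord0)).
exists (mk_smap sh); apply: smapP => y.
have [a [b [e ->]]] := nebk1_mk2 y.
rewrite cobord0E smapB /= /h0 /=.
have E (m : neb_map phi S Q) : nebk_map m (mk2 e) =
    mk2 (etrans (nm_ev m a) (etrans (congr1 phi e) (esym (nm_ev m b)))).
  exact: nebk1E.
rewrite !E; set e1 := etrans _ _; set e2 := etrans _ _.
have := cocycle1P z e2 (ee b); have := cocycle1P z (ee a) e1.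
rewrite (Prop_irrelevance (etrans (ee a) e1) (etrans e2 (ee b))) => <- h.
by apply/eqP; rewrite subr_eq addrAC eq_sym subr_eq addrC h addrC.
Qed.
End CechPull.

Section Refinements.
Variable R : realType.
Implicit Types X Y Z : diffType R.

Section IndexNeb.
Variables (X Y : diffType R) (phi : Y -> X) (S : genfam Y) (Q : genfam X).
Variable ix : forall b : gf_index S, {a : gf_index Q & {f : gf_dom b -> gf_dom a |
  esmooth f /\ forall v, pmap (p := sval a) (f v) = phi (pmap (p := sval b) v)}}.

Definition ix_neb (y : nebula S) : nebula Q :=
  existT _ (projT1 (ix (projT1 y))) (sval (projT2 (ix (projT1 y))) (projT2 y)).

Fact ix_neb_smooth : smooth ix_neb.
Proof.
move=> D p pp; apply: elocally_mono pp => E i [b [l pl lE]].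
exists (projT1 (ix b)), (sval (projT2 (ix b)) \o l).
  by apply: esmooth_comp => //; have [] := svalP (projT2 (ix b)).
by apply/funext => u /=; have /= -> := congr1 (@^~ u) lE.
Qed.

Fact ix_neb_ev y : ev (ix_neb y) = phi (ev y).
Proof. by case: y => b v; have [_] := svalP (projT2 (ix b)); apply. Qed.

Definition ix_neb_map : neb_map phi S Q := NebMap ix_neb_smooth ix_neb_ev.
End IndexNeb.

Definition idref X (Q : genfam X) : refinement Q Q :=
  @Refinement _ _ Q Q id (fun _ => id) (fun _ => @esmooth_id _ _)
    (fun _ _ => erefl).

Fact comp_rf_smooth X (Q S T : genfam X) (f : refinement Q S) (g : refinement S T)
  b : esmooth (rf_map f (b := rf_index g b) \o rf_map g (b := b)).
Proof. by apply: esmooth_comp; apply: rf_smooth. Qed.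

Definition compref X (Q S T : genfam X) (f : refinement Q S) (g : refinement S T)
    : refinement Q T :=
  @Refinement _ _ Q T (rf_index f \o rf_index g)
    (fun b => rf_map f (b := rf_index g b) \o rf_map g (b := b))
    (comp_rf_smooth f g)
    (fun b v => etrans (rf_ev _ _) (rf_ev _ _)).

Section PullFam.
Variables (X Y : diffType R) (phi : Y -> X) (sphi : smooth phi).
Variables (Q : genfam X) (S : genfam Y).

Definition pull_set : set (plot_of Y) := [set r : plot_of Y |
  (exists2 q, gf_set Q q & exists2 f : pdom r -> pdom q, esmooth f &
     forall v, pmap (p := q) (f v) = phi (r v)) /\
  (exists2 s, gf_set S s & exists2 f : pdom r -> pdom s, esmooth f &
     forall v, pmap (p := s) (f v) = r v)].

Fact factor_stable Z (T : set (plot_of Z)) (D : edom R) (p : D -> Z) :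
  estable (fun E (i : E -> D) =>
      exists2 q : plot_of Z, T q &
        exists2 f : E -> pdom q, esmooth f & p \o i = pmap (p:=q) \o f).
Proof.
move=> E E' i h sh [q Tq [f sf fE]]; exists q => //; exists (f \o h).
  exact: esmooth_comp.
by rewrite compA fE.
Qed.

Fact pull_generating : generating pull_set.
Proof.
move=> D p pp.
have l1 := gf_gen Q (sphi pp); have l2 := gf_gen S pp.
have l3 := plot_elocallyP pp.
have l12 := elocally_and (@factor_stable _ _ _ _) (@factor_stable _ _ _ _) l1 l2.
have s12 : estable (fun E (i : E -> D) =>
   (exists2 q : plot_of X, gf_set Q q &
        exists2 f : E -> pdom q, esmooth f & (phi \o p) \o i = pmap (p:=q) \o f) /\
   (exists2 q : plot_of Y, gf_set S q &
        exists2 f : E -> pdom q, esmooth f & p \o i = pmap (p:=q) \o f)).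
  move=> E E' i h sh [h1 h2]; split.
    exact: (factor_stable sh h1).
  exact: (factor_stable sh h2).
have l := elocally_and s12 (@estable_plot _ _ _ p) l12 l3.
apply: elocally_mono l => E i [[[q Qq [f sf fE]] [s Ss [g sg gE]]] pi].
exists (PlotOf pi); last by exists id => //; apply: esmooth_id.
split.
  exists q => //; exists f => // v; exact: (esym (congr1 (@^~ v) fE)).
by exists s => //; exists g => // v; exact: (esym (congr1 (@^~ v) gE)).
Qed.

Definition pull_fam : genfam Y := GenFam pull_generating.

Fact pull_ix (b : gf_index pull_fam) : {a : gf_index Q & {f : gf_dom b -> gf_dom a |
  esmooth f /\ forall v, pmap (p := sval a) (f v) = phi (pmap (p := sval b) v)}}.
Proof.
have [/cid2 [q Qq /cid2 [f sf fE]] _] := svalP b.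
by exists (exist _ q Qq), f.
Qed.

Definition pull_neb : neb_map phi pull_fam Q := ix_neb_map pull_ix.

Fact pull_ixr (b : gf_index pull_fam) : {a : gf_index S & {f : gf_dom b -> gf_dom a |
  esmooth f /\ forall v, pmap (p := sval a) (f v) = pmap (p := sval b) v}}.
Proof.
have [_ /cid2 [q Qq /cid2 [f sf fE]]] := svalP b.
by exists (exist _ q Qq), f.
Qed.

Definition pull_ref : refinement S pull_fam :=
  @Refinement _ _ S pull_fam (fun b => projT1 (pull_ixr b))
    (fun b => sval (projT2 (pull_ixr b)))
    (fun b => proj1 (svalP (projT2 (pull_ixr b))))
    (fun b => proj2 (svalP (projT2 (pull_ixr b)))).
End PullFam.

Lemma common_refinement X (Q S : genfam X) :
  exists T : genfam X, inhabited (refinement Q T * refinement S T).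
Proof.
exists (pull_fam (@smooth_id _ X) Q S); constructor; split; last exact: pull_ref.
exact: (@Refinement _ _ Q (pull_fam (@smooth_id _ X) Q S)
    (fun b => projT1 (pull_ix b))
    (fun b => sval (projT2 (pull_ix b)))
    (fun b => proj1 (svalP (projT2 (pull_ix b))))
    (fun b => proj2 (svalP (projT2 (pull_ix b))))).
Qed.

Fact all_generating X : generating [set: plot_of X].
Proof.
move=> D p pp; apply: elocally_all; first exact: factor_stable.
by exists (PlotOf pp) => //; exists id => //; apply: esmooth_id.
Qed.

Definition all_plots X : genfam X := GenFam (@all_generating X).

End Refinements.

Section CechH1.
Variables (R : realType) (G : abDiffGroupType R).
Implicit Types X Y Z : diffType R.

Section Colimit.
Variable X : diffType R.

(* The directed colimit of the [cechHQ G Q 1]: pairs of a generating family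
   and a class, identified when they agree on some common refinement. *)
Definition cech_pre : Type := {Q : genfam X & cechHQ G Q 1}.

Definition cech_eqv (a b : cech_pre) : Prop :=
  exists (S : genfam X) (f : refinement (projT1 a) S) (g : refinement (projT1 b) S),
    cechHQ_pull f (projT2 a) = cechHQ_pull g (projT2 b).

Definition cechH1 : Type := quotient cech_eqv.

Definition cech_in (Q : genfam X) (c : cechHQ G Q 1) : cechH1 :=
  qclass cech_eqv (existT _ Q c).

Lemma cech_pull_irr (Q S : genfam X) (f g : refinement Q S) (c : cechHQ G Q 1) :
  cechHQ_pull f c = cechHQ_pull g c.
Proof. exact: cechHQ_pull_homotopy. Qed.

Lemma cech_pull_compref (Q S T : genfam X) (f : refinement Q S)
    (g : refinement S T) (h : refinement Q T) (c : cechHQ G Q 1) :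
  cechHQ_pull g (cechHQ_pull f c) = cechHQ_pull h c.
Proof. by rewrite -cechHQ_pull_comp; apply: cechHQ_pull_homotopy. Qed.

Lemma cech_eqv_refl a : cech_eqv a a.
Proof. by exists (projT1 a), (idref _), (idref _). Qed.

Lemma cech_eqv_sym a b : cech_eqv a b -> cech_eqv b a.
Proof. by move=> [S [f [g e]]]; exists S, g, f. Qed.

Lemma cech_eqv_trans a b c : cech_eqv a b -> cech_eqv b c -> cech_eqv a c.
Proof.
move=> [S [f [g e]]] [S' [f' [g' e']]].
have [T [[h h']]] := common_refinement S S'.
exists T, (compref f h), (compref g' h').
rewrite -(cech_pull_compref f h) -(cech_pull_compref g' h') e -e'.
by rewrite (cech_pull_compref f' h' (compref g h)) (cech_pull_compref g h (compref g h)).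
Qed.

Lemma cech_inP (Q S : genfam X) (c : cechHQ G Q 1) (d : cechHQ G S 1) :
  cech_in c = cech_in d <->
  exists (T : genfam X) (f : refinement Q T) (g : refinement S T),
    cechHQ_pull f c = cechHQ_pull g d.
Proof.
exact: (qclassP (existT _ Q c) (existT _ S d) cech_eqv_refl cech_eqv_sym
          cech_eqv_trans).
Qed.

Lemma cech_in_surj x : exists (Q : genfam X) (c : cechHQ G Q 1), x = cech_in c.
Proof. by have [[Q c] ->] := qclass_surj x; exists Q, c. Qed.

Lemma cech_in_pull (Q S : genfam X) (f : refinement Q S) (c : cechHQ G Q 1) :
  cech_in (cechHQ_pull f c) = cech_in c.
Proof.
apply/cech_inP; exists S, (idref S), f.
exact: cech_pull_compref.
Qed.

HB.instance Definition _ := gen_eqMixin cechH1.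
HB.instance Definition _ := gen_choiceMixin cechH1.

Definition cechH1_repr (x : cechH1) : cech_pre := projT1 (cid (qclass_surj x)).

Lemma cechH1_reprK x : cech_in (projT2 (cechH1_repr x)) = x.
Proof. by rewrite /cechH1_repr; case: cid => -[Q c] /= ->. Qed.

Definition cech_zero : cechH1 := cech_in (0 : cechHQ G (all_plots X) 1).

Definition cech_opp (x : cechH1) : cechH1 := cech_in (- projT2 (cechH1_repr x)).

Definition cech_add (x y : cechH1) : cechH1 :=
  let Q := projT1 (cechH1_repr x) in let S := projT1 (cechH1_repr y) in
  cech_in (cechHQ_pull (pull_neb (@smooth_id _ X) Q S) (projT2 (cechH1_repr x)) +
           cechHQ_pull (pull_ref (@smooth_id _ X) Q S) (projT2 (cechH1_repr y))).

Lemma cech_in_pull_id (Q S : genfam X) (f : neb_map id S Q) (c : cechHQ G Q 1) :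
  cech_in (cechHQ_pull f c) = cech_in c.
Proof.
have [T [[g h]]] := common_refinement Q S.
apply/cech_inP; exists T, h, g.
by rewrite -cechHQ_pull_comp; apply: cechHQ_pull_homotopy.
Qed.

Lemma cech_addE (Q : genfam X) (c d : cechHQ G Q 1) :
  cech_add (cech_in c) (cech_in d) = cech_in (c + d).
Proof.
rewrite /cech_add.
have := cechH1_reprK (cech_in c); have := cechH1_reprK (cech_in d).
move: (cechH1_repr (cech_in c)) (cechH1_repr (cech_in d)) => [Q1 c1] [Q2 d1] /=.
set f := pull_neb _ _ _; set g := pull_ref _ _ _.
move=> /cech_inP[S2 [k2 [h2 E2]]] /cech_inP[S1 [k1 [h1 E1]]].
have [S [[s1 s2]]] := common_refinement S1 S2.
have [U [[u v]]] := common_refinement (pull_fam (@smooth_id _ X) Q1 Q2) S.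
rewrite -(cech_in_pull u) -(cech_in_pull (compref (compref h1 s1) v) (c + d)).
congr cech_in; rewrite !cechHQ_pullD; congr (_ + _).
- rewrite -(cech_pull_compref (compref h1 s1) v) -(cech_pull_compref h1 s1).
  rewrite -E1 -!cechHQ_pull_comp; exact: cechHQ_pull_homotopy.
- rewrite (cech_pull_irr _ (compref (compref h2 s2) v)).
  rewrite -(cech_pull_compref (compref h2 s2) v) -(cech_pull_compref h2 s2).
  rewrite -E2 -!cechHQ_pull_comp; exact: cechHQ_pull_homotopy.
Qed.

Lemma cech_common2 (x y : cechH1) :
  exists (Q : genfam X) (c d : cechHQ G Q 1), x = cech_in c /\ y = cech_in d.
Proof.
have [Q [c ->]] := cech_in_surj x; have [S [d ->]] := cech_in_surj y.
have [T [[f g]]] := common_refinement Q S.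
by exists T, (cechHQ_pull f c), (cechHQ_pull g d); rewrite !cech_in_pull.
Qed.

Lemma cechHQ_pull0 Y (phi : Y -> X) (Q : genfam X) (S : genfam Y)
    (f : neb_map phi S Q) :
  cechHQ_pull f (0 : cechHQ G Q 1) = 0.
Proof. by apply: (addrI (cechHQ_pull f 0)); rewrite -cechHQ_pullD !addr0. Qed.

Lemma cechHQ_pullN Y (phi : Y -> X) (Q : genfam X) (S : genfam Y)
    (f : neb_map phi S Q) (c : cechHQ G Q 1) :
  cechHQ_pull f (- c) = - cechHQ_pull f c.
Proof.
by apply: (addrI (cechHQ_pull f c)); rewrite -cechHQ_pullD !subrr cechHQ_pull0.
Qed.

Lemma cech_in0 (Q : genfam X) : cech_in (0 : cechHQ G Q 1) = cech_zero.
Proof.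
have [T [[f g]]] := common_refinement Q (all_plots X).
by apply/cech_inP; exists T, f, g; rewrite !cechHQ_pull0.
Qed.

Lemma cech_oppE (Q : genfam X) (c : cechHQ G Q 1) :
  cech_opp (cech_in c) = cech_in (- c).
Proof.
rewrite /cech_opp; have /cech_inP[S [f [g E]]] := cechH1_reprK (cech_in c).
by apply/cech_inP; exists S, f, g; rewrite !cechHQ_pullN E.
Qed.

Fact cech_addC : commutative cech_add.
Proof.
move=> x y; have [Q [c [d [-> ->]]]] := cech_common2 x y.
by rewrite !cech_addE addrC.
Qed.

Fact cech_addA : associative cech_add.
Proof.
move=> x y z; have [Q [c [d [-> ->]]]] := cech_common2 x y.
have [S [e ->]] := cech_in_surj z.
have [T [[f g]]] := common_refinement Q S.
rewrite -(cech_in_pull f c) -(cech_in_pull f d) -(cech_in_pull g e).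
by rewrite !cech_addE addrA.
Qed.

Fact cech_add0 : left_id cech_zero cech_add.
Proof.
by move=> x; have [Q [c ->]] := cech_in_surj x; rewrite -(cech_in0 Q) cech_addE add0r.
Qed.

Fact cech_addN : left_inverse cech_zero cech_opp cech_add.
Proof.
move=> x; have [Q [c ->]] := cech_in_surj x.
by rewrite cech_oppE cech_addE addNr cech_in0.
Qed.

HB.instance Definition _ :=
  GRing.isZmodule.Build cechH1 cech_addA cech_addC cech_add0 cech_addN.

Lemma cech_inD (Q : genfam X) (c d : cechHQ G Q 1) :
  cech_in (c + d) = cech_in c + cech_in d.
Proof. by rewrite -cech_addE. Qed.

End Colimit.

(* Representatives are chosen to get a function; [cech_mapE] below shows that
   the value does not depend on any choice. *)
Definition cech_map X Y (phi : Y -> X) (sphi : smooth phi) (x : cechH1 X) :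
    cechH1 Y :=
  cech_in (cechHQ_pull (pull_neb sphi (projT1 (cechH1_repr x)) (all_plots Y))
             (projT2 (cechH1_repr x))).

Lemma cech_mapE X Y (phi : Y -> X) (sphi : smooth phi) (Q : genfam X)
    (S : genfam Y) (psi : neb_map phi S Q) (c : cechHQ G Q 1) :
  cech_map sphi (cech_in c) = cech_in (cechHQ_pull psi c).
Proof.
rewrite /cech_map; have := cechH1_reprK (cech_in c).
move: (cechH1_repr _) => [Q' c'] /= /cech_inP[T [f [g E]]].
set psi' := pull_neb _ _ _.
have [V [[u v]]] := common_refinement (pull_fam sphi Q' (all_plots Y)) S.
pose w := pull_ref sphi T V.
apply/cech_inP; exists (pull_fam sphi T V), (compref u w), (compref v w).
have P1 : cechHQ_pull (compref u w) (cechHQ_pull psi' c') =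
    cechHQ_pull (pull_neb sphi T V) (cechHQ_pull f c').
  by rewrite -!cechHQ_pull_comp; apply: cechHQ_pull_homotopy.
have P2 : cechHQ_pull (compref v w) (cechHQ_pull psi c) =
    cechHQ_pull (pull_neb sphi T V) (cechHQ_pull g c).
  by rewrite -!cechHQ_pull_comp; apply: cechHQ_pull_homotopy.
by rewrite P1 P2 E.
Qed.

End CechH1.

(* Main.v *)
Require Import Defs.
From mathcomp Require Import all_boot all_order all_algebra.
From mathcomp Require Import all_classical all_reals topology normedtype landau derive.

(** Fix a generating family [Q] of [X] and a principal bundle [P] over [X], and
    suppose that [ev : nebula Q -> X] lifts to a smooth map [s] into [P].  The
    action being free and transitive on fibres, [s b = s a + z(a, b)] for a
    unique [z(a, b)] in [G] whenever [ev a = ev b]; these transition elements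
    form a smooth Cech 1-cocycle.  Such an [s] exists as soon as the plots in
    [Q] lift to [P], and the plots that do lift form a generating family, because
    [P / G] carries the quotient diffeology.  So every bundle has a class, and
    the theorem says that this class determines the bundle and is arbitrary.

    Independence of all choices, invariance under isomorphism and naturality
    under pullback are one and the same statement, [transition_natural]: if
    [F : P' -> P] is smooth and equivariant over [phi : Y -> X], the division
    of the lift [s] of [P] by the image under [F] of a lift [t] of [P'], both
    pulled back to a common family over [Y], is a 0-cochain whose coboundary is
    the difference of the two transition cocycles.

    For injectivity, equality in the colimit means that after refinement the
    cocycles of two bundles differ by the coboundary of some [h]; moving one of
    the lifts by [h] makes the cocycles equal.  Then [s a + g |-> t a + g] is
    well defined over each point of [X], and it is an isomorphism, smooth because
    plots of [X] locally factor through the nebula ([glue_map], [glueK]).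

    For surjectivity, a cocycle [z] on [Q] glues the trivial bundle
    [nebula Q * G] along [(a, z(a, b) + g) ~ (b, g)]; the quotient is a principal
    bundle, and the zero section of the trivial bundle is a lift of [ev] with
    transition cocycle [z] ([transition_cocycle_lifting]). *)

Set Implicit Arguments.
Unset Strict Implicit.
Unset Printing Implicit Defensive.
Import GRing.Theory.
Local Open Scope classical_set_scope.
Local Open Scope ring_scope.

(** * Isomorphism classes of bundles *)

Section BundleClasses.
Variables (R : realType) (G : abDiffGroupType R) (X : diffType R).
Implicit Types P : principal_bundle G X.

Lemma bundle_map_comp P P' P'' (f : P' -> P'') (g : P -> P') :
  bundle_map f -> bundle_map g -> bundle_map (f \o g).
Proof.
move=> [sf fA fP] [sg gA gP]; split; first exact: smooth_comp.
  by move=> p h; rewrite /= gA fA.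
by move=> p; rewrite /= fP gP.
Qed.

Lemma bundle_iso_refl P : bundle_iso P P.
Proof. by exists id, id; split=> //; split. Qed.

Lemma bundle_iso_sym P P' : bundle_iso P P' -> bundle_iso P' P.
Proof. by move=> [f [g [mf mg fK gK]]]; exists g, f. Qed.

Lemma bundle_iso_trans P P' P'' :
  bundle_iso P P' -> bundle_iso P' P'' -> bundle_iso P P''.
Proof.
move=> [f [g [mf mg fK gK]]] [f' [g' [mf' mg' fK' gK']]].
exists (f' \o f), (g \o g'); split.
- exact: bundle_map_comp.
- exact: bundle_map_comp.
- exact: can_comp.
- exact: can_comp.
Qed.

Lemma class_of_bundle_eq P P' :
  bundle_iso P P' -> class_of_bundle P = class_of_bundle P'.
Proof.
move=> PP'; apply: sval_inj => /=; apply/funext => P''; apply/propext; split.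
  by apply: bundle_iso_trans; apply: bundle_iso_sym.
exact: bundle_iso_trans.
Qed.

End BundleClasses.

(** * Plots and nebulas *)

Section Plots.
Variables (R : realType) (G : abDiffGroupType R).

Lemma plotD (D : edom R) (f g : D -> G) :
  plot f -> plot g -> plot (fun u => f u + g u).
Proof.
by move=> pf pg; exact: (@add_smooth R G D (fun u => (f u, g u)) (conj pf pg)).
Qed.

Lemma plotN (D : edom R) (f : D -> G) : plot f -> plot (fun u => - f u).
Proof. exact: (@opp_smooth R G D f). Qed.

Lemma estable_lift (A X : diffType R) (pi : A -> X) (D : edom R) (r : D -> X) :
  estable (fun E (i : E -> D) =>
    exists2 l : E -> A, plot l & r \o i = pi \o l).
Proof.
move=> E E' i h sh [l pl lE]; exists (l \o h); first exact: plot_comp.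
by rewrite compA lE.
Qed.

(** Being a subduction forces surjectivity: lift the constant plots on the
    one-point domain of dimension 0. *)
Lemma lift_surj (A X : diffType R) (pi : A -> X) :
  (forall (D : edom R) (r : D -> X), plot r ->
    elocally (fun E (i : E -> D) =>
      exists2 l : E -> A, plot l & r \o i = pi \o l)) ->
  forall x, exists a, pi a = x.
Proof.
move=> lift x; pose D : edom R := @EDom R 0 setT openT.
pose o : D := exist _ 0 I.
have [W [oW [Wo [l _ lE]]]] := lift D _ (@plot_cst R X D x) o.
pose w : esub oW := exist _ (sval o) (conj I Wo).
by exists (l w); have := congr1 (@^~ w) lE.
Qed.

End Plots.

Section Nebulas.
Variables (R : realType) (X : diffType R) (Q : genfam X).

(** A plot of a coproduct lies locally in one summand, so smoothness is only to
    be tested on the members of the family. *)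
Lemma smooth_nebula (Y : diffType R) (f : nebula Q -> Y) :
  (forall a : gf_index Q, plot (fun u : gf_dom a => f (existT _ a u))) ->
  smooth f.
Proof.
move=> pf D p pp; apply: plot_local; apply: elocally_mono pp => E i [a [l pl lE]].
rewrite -compA lE; exact: (plot_comp (pf a) pl).
Qed.

Lemma ev_smooth : smooth (@ev R X Q).
Proof. by apply: smooth_nebula => a; apply: (pmapP (sval a)). Qed.

(** This is the generating property of [Q], read as: [ev] is a subduction. *)
Lemma ev_lift (D : edom R) (r : D -> X) : plot r ->
  elocally (fun E (i : E -> D) =>
    exists2 l : E -> nebula Q, plot l & r \o i = @ev R X Q \o l).
Proof.
move=> pr; apply: elocally_mono (gf_gen Q pr) => E i [q Qq [f sf fE]].
exists (fun u => existT _ (exist _ q Qq) (f u)); last by rewrite fE.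
apply: elocally_all; first exact: coprod_stable.
by exists (exist _ q Qq), f.
Qed.

Lemma ev_surj x : exists a : nebula Q, ev a = x.
Proof. exact: (lift_surj ev_lift). Qed.

End Nebulas.

(** * Degree one cocycles as functions of two points *)

Section CocycleFunctions.
Variables (R : realType) (G : abDiffGroupType R) (X : diffType R) (Q : genfam X).

(** Extending a cocycle by 0 to pairs with distinct images frees the later
    computations from proofs of [ev a = ev b] inside terms. *)
Definition cocycle2 (z : cocycle G Q 1) (a b : nebula Q) : G :=
  if pselect (ev a = ev b) is left e then z (mk2 e) else 0.

Lemma cocycle2E (z : cocycle G Q 1) a b (e : ev a = ev b) :
  cocycle2 z a b = z (mk2 e).
Proof.
rewrite /cocycle2; case: pselect => // e'.
by rewrite (Prop_irrelevance e e').
Qed.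

Lemma cocycle2D (z : cocycle G Q 1) a b c : ev a = ev b -> ev b = ev c ->
  cocycle2 z a b + cocycle2 z b c = cocycle2 z a c.
Proof.
by move=> e e'; rewrite (cocycle2E z e) (cocycle2E z e') cocycle1P -cocycle2E.
Qed.

Lemma cocycle2_refl (z : cocycle G Q 1) a : cocycle2 z a a = 0.
Proof. by apply: (addrI (cocycle2 z a a)); rewrite cocycle2D// addr0. Qed.

Lemma cocycle2_plot (z : cocycle G Q 1) (D : edom R) (a b : D -> nebula Q) :
  plot a -> plot b -> (forall u, ev (a u) = ev (b u)) ->
  plot (fun u => cocycle2 z (a u) (b u)).
Proof.
move=> pa pb e; under eq_fun do rewrite (cocycle2E z (e _)).
by apply: (smap_smooth z (p := fun u => mk2 (e u))) => -[[|i] ?].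
Qed.

Lemma eq_cocycle2 (z w : cocycle G Q 1) :
  (forall a b, ev a = ev b -> cocycle2 z a b = cocycle2 w a b) -> z = w.
Proof.
move=> zw; apply: val_inj; apply: smapP => x; have [a [b [e ->]]] := nebk1_mk2 x.
by have := zw _ _ e; rewrite !(cocycle2E _ e).
Qed.

Lemma cohomologousP (z w : cocycle G Q 1) :
  cech_class z = cech_class w <->
  exists2 h : nebula Q -> G, smooth h & forall a b, ev a = ev b ->
    cocycle2 z a b = cocycle2 w a b + (h b - h a).
Proof.
rewrite cech_classP; split=> [[h hE]|[h sh hE]].
  exists (fun a => h (mk1 a)).
    by move=> D p pp; apply: (smap_smooth h (p := fun u => mk1 (p u))) => i.
  move=> a b e; rewrite !(cocycle2E _ e) -cobord0E -hE smapB.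
  by rewrite addrC subrK.
have sh1 : smooth (fun y : nebk Q 0 => h (sval y ord0)).
  by move=> D p pp; apply: (sh _ (fun u => sval (p u) ord0)); apply: pp.
exists (mk_smap sh1); apply: smapP => x; have [a [b [e ->]]] := nebk1_mk2 x.
rewrite cobord0E smapB /=; have := hE _ _ e; rewrite !(cocycle2E _ e) => zE.
apply/eqP; rewrite subr_eq addrC; exact/eqP.
Qed.

Section MkCocycle.
Variable f : nebula Q -> nebula Q -> G.
Hypothesis f_plot : forall (D : edom R) (a b : D -> nebula Q),
  plot a -> plot b -> (forall u, ev (a u) = ev (b u)) ->
  plot (fun u => f (a u) (b u)).
Hypothesis fD : forall a b c, ev a = ev b -> ev b = ev c ->
  f a b + f b c = f a c.

Fact mk_cocycle_smooth :
  smooth (fun x : nebk Q 1 => f (sval x ord0) (sval x ord_max)).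
Proof.
move=> D p pp.
by apply: (f_plot (pp ord0) (pp ord_max)) => u; exact: (svalP (p u)).
Qed.

Fact mk_cocycle_subproof : mk_smap mk_cocycle_smooth \in @cocycle_pred R G X Q 1.
Proof.
apply/eqP; apply: smapP => x.
rewrite cobordE !big_ord_recl big_ord0 smap0 addr0.
rewrite expr0 expr1 mulrNz expr2 mulrNN !mulr1z /=.
have xE (i : 'I_3) (j : 'I_2) (k : 'I_3) : lift i j = k :> nat ->
  sval x (lift i j) = sval x k by move=> e; congr (sval x _); apply: val_inj.
(* The [i]-th face of [x] drops the [i]-th of its three points. *)
pose i1 : 'I_3 := @Ordinal 3 1 isT.
pose i2 : 'I_3 := ord_max.
rewrite (xE ord0 ord0 i1 erefl) (xE ord0 ord_max i2 erefl).
rewrite (xE (lift ord0 ord0) ord0 ord0 erefl) (xE (lift ord0 ord0) ord_max i2 erefl).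
rewrite (xE (lift ord0 (lift ord0 ord0)) ord0 ord0 erefl).
rewrite (xE (lift ord0 (lift ord0 ord0)) ord_max i1 erefl).
rewrite -(fD (svalP x ord0 i1) (svalP x i1 i2)).
by rewrite opprD [- _ - _]addrC subrK subrr.
Qed.

Definition mk_cocycle : cocycle G Q 1 := Cocycle mk_cocycle_subproof.

Lemma mk_cocycleE a b : ev a = ev b -> cocycle2 mk_cocycle a b = f a b.
Proof. by move=> e; rewrite (cocycle2E _ e). Qed.

End MkCocycle.

End CocycleFunctions.

Lemma cocycle2_pull (R : realType) (G : abDiffGroupType R) (X Y : diffType R)
    (phi : Y -> X) (S : genfam Y) (Q : genfam X) (psi : neb_map phi S Q)
    (z : cocycle G Q 1) (a b : nebula S) : ev a = ev b ->
  cocycle2 (cocycle_pull psi z) a b = cocycle2 z (psi a) (psi b).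
Proof.
move=> e; have e' : ev (psi a) = ev (psi b) by rewrite !nm_ev e.
rewrite (cocycle2E _ e) (cocycle2E _ e') /=; congr (smap_fun (cocycle_val z) _).
exact: nebk1E.
Qed.

(** * Division in a principal bundle *)

Section PrincipalBundles.
Variables (R : realType) (G : abDiffGroupType R).

Section Bundle.
Variables (X : diffType R) (P : principal_bundle G X).

(** The element taking [p] to [q]; the default 0 is met only when [p] and [q]
    lie in different fibres. *)
Definition pdiv (p q : P) : G := xget 0 [set g | pb_act p g = q].

Lemma pb_act_inj (p : P) : injective (pb_act p).
Proof.
move=> g h e; have [_ [k [_ kK _]]] := pb_principal P.
set F := (F in cancel F k) in kK.
have E : F (p, g) = F (p, h) by apply: sval_inj; rewrite /= e.
by have := congr1 k E; rewrite !kK => -[].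
Qed.

Lemma pdivK (p q : P) : pb_proj p = pb_proj q -> pb_act p (pdiv p q) = q.
Proof.
move=> /orbit_relP[g ->]; rewrite /pdiv.
have : exists h, [set h | pb_act p h = pb_act p g] h by exists g.
by move=> /(xgetPex 0).
Qed.

Lemma pdiv_act (p : P) g : pdiv p (pb_act p g) = g.
Proof. by apply: (@pb_act_inj p); rewrite pdivK// pb_proj_act. Qed.

Lemma pdivD (p q r : P) : pb_proj p = pb_proj q -> pb_proj q = pb_proj r ->
  pdiv p q + pdiv q r = pdiv p r.
Proof.
move=> e e'; apply: (@pb_act_inj p).
by rewrite pb_actD !pdivK// e.
Qed.

(** On pairs of points of a common fibre, division is the second component of the
    inverse of the diffeomorphism [(p, g) |-> (p, p + g)], hence smooth. *)
Lemma pdiv_plot (D : edom R) (p q : D -> P) : plot p -> plot q ->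
  (forall u, pb_proj (p u) = pb_proj (q u)) -> plot (fun u => pdiv (p u) (q u)).
Proof.
move=> pp pq e; have [_ [k [sk _ kK]]] := pb_principal P.
pose c u : {w : P * P | pb_proj w.1 = pb_proj w.2} := exist _ (p u, q u) (e u).
have -> : (fun u => pdiv (p u) (q u)) = (fun u => (k (c u)).2).
  apply/funext => u; have /(congr1 sval)/= := kK (c u).
  by move: (k _) => [p' g] [-> <-]; rewrite pdiv_act.
exact: (sk _ c (conj pp pq)).2.
Qed.

Lemma act_plot (D : edom R) (p : D -> P) (g : D -> G) : plot p -> plot g ->
  plot (fun u => pb_act (p u) (g u)).
Proof. by move=> pp pg; exact: (@pb_act_smooth _ _ _ P D (fun u => (p u, g u))). Qed.

End Bundle.

(** * The Cech class of a principal bundle *)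

Section BundleSection.
Variables (X : diffType R) (P : principal_bundle G X) (Q : genfam X).

(** A trivialization of the pullback of [P] to the nebula, given by a section:
    local sections of [P] along all the plots of [Q], with no compatibility. *)
Record lifting := Lifting {
  lift_fun :> nebula Q -> P;
  lift_smooth : smooth lift_fun;
  lift_proj : forall a, pb_proj (lift_fun a) = ev a }.

Lemma lift_projE (s : lifting) a b : ev a = ev b ->
  pb_proj (s a) = pb_proj (s b).
Proof. by rewrite !lift_proj. Qed.

Variable s : lifting.

Fact transition_plot (D : edom R) (a b : D -> nebula Q) :
  plot a -> plot b -> (forall u, ev (a u) = ev (b u)) ->
  plot (fun u => pdiv (s (a u)) (s (b u))).
Proof.
move=> pa pb e; apply: (pdiv_plot (p := s \o a) (q := s \o b)).
- exact: lift_smooth.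
- exact: lift_smooth.
- by move=> u; apply: lift_projE.
Qed.

Fact transitionD a b c : ev a = ev b -> ev b = ev c ->
  pdiv (s a) (s b) + pdiv (s b) (s c) = pdiv (s a) (s c).
Proof. by move=> e e'; rewrite pdivD//; apply: lift_projE. Qed.

Definition transition : cocycle G Q 1 := mk_cocycle transition_plot transitionD.

Lemma transitionE a b : ev a = ev b ->
  cocycle2 transition a b = pdiv (s a) (s b).
Proof. exact: mk_cocycleE. Qed.

End BundleSection.

Section LocalSections.
Variables (X : diffType R) (P : principal_bundle G X).

(** Every plot of [X] lifts to [P] locally, so the liftable plots generate. *)
Fact liftable_generating : generating
  [set q : plot_of X | exists2 l : pdom q -> P,
    plot l & forall u, pb_proj (l u) = q u].
Proof.
move=> D p pp.
have := elocally_and (@estable_lift _ _ _ _ _ _) (@estable_plot _ _ _ p)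
  (pb_proj_lift P pp) (plot_elocallyP pp).
apply: elocally_mono => E i [[l pl lE] pi].
exists (PlotOf pi); last by exists id => //; apply: esmooth_id.
by exists l => // u; rewrite -[LHS]/((_ \o l) u) -lE.
Qed.

Definition liftable : genfam X := GenFam liftable_generating.

Definition liftable_fun (a : nebula liftable) : P :=
  s2val (cid2 (svalP (projT1 a))) (projT2 a).

Fact liftable_smooth : smooth liftable_fun.
Proof. by apply: smooth_nebula => a; exact: (s2valP (cid2 (svalP a))). Qed.

Fact liftable_proj a : pb_proj (liftable_fun a) = ev a.
Proof. by case: a => a u; exact: (s2valP' (cid2 (svalP a))). Qed.

Definition liftable_lifting : lifting P liftable :=
  Lifting liftable_smooth liftable_proj.

End LocalSections.

(** Over a common family, with [psi] and [r] its maps to [Q] and [S], the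
    0-cochain [h a] that moves [s (psi a)] to [F (t (r a))] exists because both
    points lie over [phi (ev a)].  As [F] is equivariant, it preserves division,
    so moving from [s (psi a)] to [F (t (r b))] through [s (psi b)] or through
    [F (t (r a))] compares the two cocycles. *)
Lemma transition_natural (X Y : diffType R) (phi : Y -> X) (sphi : smooth phi)
    (P : principal_bundle G X) (P' : principal_bundle G Y) (F : P' -> P)
    (Q : genfam X) (S : genfam Y) (s : lifting P Q) (t : lifting P' S) :
  smooth F -> (forall p g, F (pb_act p g) = pb_act (F p) g) ->
  (forall p, pb_proj (F p) = phi (pb_proj p)) ->
  cech_map sphi (cech_in (cech_class (transition s))) =
  cech_in (cech_class (transition t)).
Proof.
move=> sF FA FP; pose psi := pull_neb sphi Q S; pose r := pull_ref sphi Q S.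
rewrite (cech_mapE _ psi) -(cech_in_pull r) !cechHQ_pullE; congr cech_in.
have e0 a : pb_proj (s (psi a)) = pb_proj (F (t (r a))).
  by rewrite FP !lift_proj !nm_ev.
apply/esym/cohomologousP.
exists (fun a => pdiv (s (psi a)) (F (t (r a)))).
  move=> D p pp; apply: (pdiv_plot (p := s \o (psi \o p))
    (q := F \o (t \o (r \o p)))).
  - exact: (lift_smooth s (nm_smooth psi pp)).
  - exact: (sF _ _ (lift_smooth t (nm_smooth r pp))).
  - by move=> u; apply: e0.
move=> a b e; rewrite !cocycle2_pull//.
have ep : ev (psi a) = ev (psi b) by rewrite !nm_ev e.
have er : ev (r a) = ev (r b) by rewrite !nm_ev e.
rewrite !transitionE// addrA pdivD//; last exact: lift_projE.
have -> : pdiv (t (r a)) (t (r b)) = pdiv (F (t (r a))) (F (t (r b))).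
  by rewrite -[in RHS](pdivK (lift_projE t er)) FA pdiv_act.
have eF : pb_proj (F (t (r a))) = pb_proj (F (t (r b))).
  by rewrite !FP; congr phi; apply: lift_projE.
by rewrite -(pdivD (e0 a) eF) [X in X - _]addrC addrK.
Qed.

Lemma cech_map_id (X : diffType R) (c : cechH1 G X) :
  cech_map (@smooth_id _ X) c = c.
Proof.
by have [Q [d ->]] := cech_in_surj c; rewrite (cech_mapE _ (idref Q)) cech_in_pull.
Qed.

Definition bundle_cech (X : diffType R) (P : principal_bundle G X) : cechH1 G X :=
  cech_in (cech_class (transition (liftable_lifting P))).

Lemma bundle_cechE (X : diffType R) (P : principal_bundle G X) (Q : genfam X)
    (s : lifting P Q) : bundle_cech P = cech_in (cech_class (transition s)).
Proof.
rewrite -(cech_map_id (bundle_cech P)).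
by rewrite /bundle_cech (@transition_natural _ _ id _ P P id _ _ _ s).
Qed.

Lemma bundle_cech_natural (X Y : diffType R) (phi : Y -> X) (sphi : smooth phi)
    (P : principal_bundle G X) (P' : principal_bundle G Y) (F : P' -> P) :
  smooth F -> (forall p g, F (pb_act p g) = pb_act (F p) g) ->
  (forall p, pb_proj (F p) = phi (pb_proj p)) ->
  cech_map sphi (bundle_cech P) = bundle_cech P'.
Proof. exact: transition_natural. Qed.

Lemma bundle_cech_iso (X : diffType R) (P P' : principal_bundle G X) :
  bundle_iso P P' -> bundle_cech P = bundle_cech P'.
Proof.
move=> [_ [F [_ [sF FA FP] _ _]]]; rewrite -(cech_map_id (bundle_cech P)).
exact: bundle_cech_natural FP.
Qed.

Lemma bundle_cech_pullback (X Y : diffType R) (phi : Y -> X) (sphi : smooth phi)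
    (P : principal_bundle G X) :
  bundle_cech (pullback_bundle sphi P) = cech_map sphi (bundle_cech P).
Proof.
symmetry; apply: (@bundle_cech_natural _ _ _ _ _ (pullback_bundle sphi P)
  (fun z : pull_total phi P => (sval z).1)) => //.
- by move=> D p pp; exact: pp.1.
- by move=> p; exact: (svalP p).
Qed.

(** * Cohomologous transition cocycles come from isomorphic bundles *)

Section ChangeLifting.
Variables (X : diffType R) (P : principal_bundle G X).

Fact pull_lifting_smooth (Q S : genfam X) (f : neb_map id S Q) (s : lifting P Q) :
  smooth (s \o f).
Proof. exact: (smooth_comp (lift_smooth s) (nm_smooth f)). Qed.

Fact pull_lifting_proj (Q S : genfam X) (f : neb_map id S Q) (s : lifting P Q) a :
  pb_proj (s (f a)) = ev a.
Proof. by rewrite lift_proj nm_ev. Qed.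

Definition pull_lifting (Q S : genfam X) (f : neb_map id S Q) (s : lifting P Q) :
  lifting P S := Lifting (pull_lifting_smooth f s) (pull_lifting_proj f s).

Lemma transition_pull (Q S : genfam X) (f : neb_map id S Q) (s : lifting P Q) :
  transition (pull_lifting f s) = cocycle_pull f (transition s).
Proof.
apply: eq_cocycle2 => a b e; rewrite cocycle2_pull// !transitionE//.
by rewrite !nm_ev e.
Qed.

Variables (Q : genfam X) (s : lifting P Q) (h : nebula Q -> G).
Hypothesis sh : smooth h.

Fact twist_lifting_smooth : smooth (fun a => pb_act (s a) (h a)).
Proof. by move=> D p pp; apply: act_plot; [exact: (lift_smooth s pp)|exact: sh]. Qed.

Fact twist_lifting_proj a : pb_proj (pb_act (s a) (h a)) = ev a.
Proof. by rewrite pb_proj_act lift_proj. Qed.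

Definition twist_lifting : lifting P Q :=
  Lifting twist_lifting_smooth twist_lifting_proj.

(** As [G] is commutative, [h a] cancels past the transition from [a] to [b], so
    that a change of lifting changes the cocycle by a coboundary. *)
Lemma transition_twist a b : ev a = ev b ->
  cocycle2 (transition twist_lifting) a b =
  cocycle2 (transition s) a b + (h b - h a).
Proof.
move=> e; rewrite !transitionE//=; apply: (@pb_act_inj _ _ (pb_act (s a) (h a))).
rewrite pdivK; last by rewrite !pb_proj_act; apply: lift_projE.
by rewrite -pb_actD addrC addrA subrK pb_actD pdivK//; apply: lift_projE.
Qed.

End ChangeLifting.

Section Glue.
Variables (X : diffType R) (Q : genfam X).

Section GlueMap.
Variables (P P' : principal_bundle G X) (s : lifting P Q) (t : lifting P' Q).
Hypothesis st : transition s = transition t.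

(** The map [s a + g |-> t a + g]; it does not depend on [a] because the two
    liftings have the same transition cocycle. *)
Definition glue (p : P) : P' :=
  let a := projT1 (cid (ev_surj Q (pb_proj p))) in pb_act (t a) (pdiv (s a) p).

Lemma glueE p a : ev a = pb_proj p -> glue p = pb_act (t a) (pdiv (s a) p).
Proof.
rewrite /glue; case: cid => b /= eb ea; have e : ev a = ev b by rewrite ea.
have sp c : ev c = pb_proj p -> pb_proj (s c) = pb_proj p by rewrite lift_proj.
rewrite -(pdivD (lift_projE s e) (sp _ eb)) pb_actD -(transitionE s e) st.
by rewrite transitionE// pdivK//; apply: lift_projE.
Qed.

Lemma glue_map : bundle_map glue.
Proof.
split=> [D p pp|p g|p].
- apply: plot_local.
  have sp := @pb_proj_smooth _ _ _ P _ _ pp.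
  have := elocally_and (@estable_lift _ _ _ _ _ _) (@estable_plot _ _ _ p)
    (ev_lift Q sp) (plot_elocallyP pp).
  apply: elocally_mono => E i [[l pl lE] ppi].
  have e u : ev (l u) = pb_proj (p (i u)) by rewrite -[LHS]/((@ev _ _ Q \o l) u) -lE.
  have -> : (glue \o p) \o i = fun u => pb_act (t (l u)) (pdiv (s (l u)) (p (i u))).
    by apply/funext => u /=; apply: glueE.
  apply: act_plot; first exact: (lift_smooth t pl).
  apply: (pdiv_plot (p := s \o l) (q := p \o i)) => //.
    exact: (lift_smooth s pl).
  by move=> u; rewrite /= lift_proj.
- have [a ea] := ev_surj Q (pb_proj p).
  rewrite (glueE ea) (@glueE _ a) ?pb_proj_act// -pb_actD; congr pb_act.
  have sp : pb_proj (s a) = pb_proj p by rewrite lift_proj.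
  by rewrite -(pdivD sp) ?pb_proj_act// pdiv_act.
- have [a ea] := ev_surj Q (pb_proj p).
  by rewrite (glueE ea) pb_proj_act lift_proj.
Qed.

End GlueMap.

Lemma glueK (P P' : principal_bundle G X) (s : lifting P Q) (t : lifting P' Q) :
  transition s = transition t -> cancel (glue s t) (glue t s).
Proof.
move=> st p; have [a ea] := ev_surj Q (pb_proj p).
rewrite (glueE st ea) (glueE (esym st) (a := a)) ?pb_proj_act ?lift_proj//.
by rewrite pdiv_act pdivK ?lift_proj.
Qed.

Lemma transition_inj (P P' : principal_bundle G X)
    (s : lifting P Q) (t : lifting P' Q) :
  transition s = transition t -> bundle_iso P P'.
Proof.
move=> st; exists (glue s t), (glue t s).
by split; [exact: glue_map|exact: glue_map|exact: glueK|exact: glueK].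
Qed.

End Glue.

(** Refining identifies the classes of the cocycles on one family, twisting one
    of the liftings then identifies the cocycles themselves. *)
Lemma bundle_cech_inj (X : diffType R) (P P' : principal_bundle G X) :
  bundle_cech P = bundle_cech P' -> bundle_iso P P'.
Proof.
have s := liftable_lifting P; have t := liftable_lifting P'.
rewrite (bundle_cechE s) (bundle_cechE t) => /cech_inP[T [f [g]]].
rewrite !cechHQ_pullE -!transition_pull => /cohomologousP[h sh E].
apply: (@transition_inj _ _ _ _ (pull_lifting f s)
  (twist_lifting (pull_lifting g t) sh)).
by apply: eq_cocycle2 => a b e; rewrite transition_twist// E.
Qed.

(** * The bundle glued from a cocycle *)

Section MkBundle.
Variables (X P : diffType R) (act : P -> G -> P) (proj : P -> X).
Hypothesis act0 : forall p, act p 0 = p.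
Hypothesis actD : forall p g h, act p (g + h) = act (act p g) h.
Hypothesis act_smooth : smooth (fun z : P * G => act z.1 z.2).
Hypothesis proj_act : forall p g, proj (act p g) = proj p.
Hypothesis proj_smooth : smooth proj.
Hypothesis proj_lift : forall (D : edom R) (r : D -> X), plot r ->
  elocally (fun E (i : E -> D) =>
    exists2 l : E -> P, plot l & r \o i = proj \o l).
Variable div : P -> P -> G.
Hypothesis divK : forall p q, proj p = proj q -> act p (div p q) = q.
Hypothesis div_act : forall p g, div p (act p g) = g.
Hypothesis div_plot : forall (D : edom R) (p q : D -> P), plot p -> plot q ->
  (forall u, proj (p u) = proj (q u)) -> plot (fun u => div (p u) (q u)).

Fact mk_orbitP p q : orbit_rel act p q <-> proj p = proj q.
Proof. by split=> [[g ->]|e]; [rewrite proj_act|exists (div p q); rewrite divK]. Qed.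

Fact mk_orbit_class p q : qclass (orbit_rel act) p = qclass (orbit_rel act) q <->
  proj p = proj q.
Proof.
rewrite qclassP; first exact: mk_orbitP.
- by move=> r; apply/mk_orbitP.
- by move=> r r' /mk_orbitP e; apply/mk_orbitP.
- by move=> r r' r'' /mk_orbitP e /mk_orbitP e'; apply/mk_orbitP; rewrite e.
Qed.

Fact mk_quotient : exists h : quotient (orbit_rel act) -> X,
  diffeomorphism h /\ forall p, h (qclass _ p) = proj p.
Proof.
pose h (c : quotient (orbit_rel act)) := proj (projT1 (cid (qclass_surj c))).
have hE p : h (qclass _ p) = proj p.
  by rewrite /h; case: cid => q /= /mk_orbit_class.
pose k x := qclass (orbit_rel act) (projT1 (cid (lift_surj proj_lift x))).
have kE p : k (proj p) = qclass _ p.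
  by rewrite /k; case: cid => q /= /mk_orbit_class.
exists h; split=> //; split.
  move=> D p pp; apply: plot_local; apply: elocally_mono pp => E i [l pl lE].
  have -> : h \o p \o i = proj \o l.
    by rewrite -compA lE; apply/funext => u /=; rewrite hE.
  exact: proj_smooth.
exists k; split.
- move=> D r pr; apply: elocally_mono (proj_lift pr) => E i [l pl lE].
  by exists l => //; rewrite -compA lE; apply/funext => u /=; rewrite kE.
- by move=> c; have [p ->] := qclass_surj c; rewrite hE kE.
- by move=> x; have [p <-] := lift_surj proj_lift x; rewrite kE hE.
Qed.

Fact mk_principal : diffeomorphism (fun z : P * G =>
  exist (fun w : P * P => proj w.1 = proj w.2)
    (z.1, act z.1 z.2) (esym (proj_act z.1 z.2))).
Proof.
split; first by move=> D p pp; split; [exact: pp.1|exact: act_smooth pp].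
exists (fun w => ((sval w).1, div (sval w).1 (sval w).2)); split.
- move=> D p pp; split; first exact: pp.1.
  apply: (div_plot (p := fun u => (sval (p u)).1) (q := fun u => (sval (p u)).2)).
  + exact: pp.1.
  + exact: pp.2.
  + by move=> u; exact: (svalP (p u)).
- by move=> [p g] /=; rewrite div_act.
- by move=> [[p q] /= e]; apply: sval_inj; rewrite /= divK.
Qed.

(** Freeness and transitivity of the action on fibres are given by a division
    map [div], because a smooth one is an inverse of the action map
    [(p, g) |-> (p, p + g)]; the local lifts along [proj] make it a quotient map. *)
Definition mk_bundle : principal_bundle G X :=
  PrincipalBundle act0 actD act_smooth mk_quotient mk_principal.

End MkBundle.

Section CocycleBundle.
Variables (X : diffType R) (Q : genfam X) (z : cocycle G Q 1).

Notation chart := (nebula Q * G)%type.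

(** The sign is the one for which the zero section [s a], the class of [(a, 0)],
    satisfies [s b = s a + z(a, b)]. *)
Definition glued (a b : chart) : Prop :=
  ev a.1 = ev b.1 /\ a.2 = cocycle2 z a.1 b.1 + b.2.

Fact gluedP (a b : chart) : qclass glued a = qclass glued b <-> glued a b.
Proof.
apply: qclassP => [x|x y|x y w].
- by split=> //; rewrite cocycle2_refl add0r.
- rewrite /glued => -[e ->]; split=> //.
  by rewrite addrA cocycle2D// cocycle2_refl add0r.
- by rewrite /glued => -[e ->] [e' ->]; split; [rewrite e|rewrite addrA cocycle2D].
Qed.

Notation total := (quotient glued).
Definition chart_rep (c : total) : chart := projT1 (cid (qclass_surj c)).

Lemma chart_repK c : qclass glued (chart_rep c) = c.
Proof. by rewrite /chart_rep; case: cid. Qed.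

Lemma chart_rep_glued a : glued (chart_rep (qclass glued a)) a.
Proof. by apply/gluedP; rewrite chart_repK. Qed.

Definition cb_proj (c : total) : X := ev (chart_rep c).1.
Definition cb_act (c : total) (g : G) : total :=
  qclass glued ((chart_rep c).1, (chart_rep c).2 + g).
Definition cb_div (c d : total) : G :=
  cocycle2 z (chart_rep c).1 (chart_rep d).1 + (chart_rep d).2 - (chart_rep c).2.

Lemma cb_projE a : cb_proj (qclass glued a) = ev a.1.
Proof. by have [] := chart_rep_glued a. Qed.

Lemma cb_actE a g : cb_act (qclass glued a) g = qclass glued (a.1, a.2 + g).
Proof.
by have [e E] := chart_rep_glued a; apply/gluedP; split=> //=; rewrite E addrA.
Qed.

Lemma cb_divE a b : ev a.1 = ev b.1 ->
  cb_div (qclass glued a) (qclass glued b) = cocycle2 z a.1 b.1 + b.2 - a.2.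
Proof.
move=> e; rewrite /cb_div; have [ea ->] := chart_rep_glued a.
have [eb ->] := chart_rep_glued b.
rewrite addrA cocycle2D ?ea ?e//.
by rewrite -(cocycle2D z ea e) -[_ + _ + b.2]addrA opprD addrACA subrr add0r.
Qed.

Fact cb_act0 c : cb_act c 0 = c.
Proof. by rewrite -(chart_repK c) cb_actE addr0 -surjective_pairing. Qed.

Fact cb_actD c g h : cb_act c (g + h) = cb_act (cb_act c g) h.
Proof. by rewrite -(chart_repK c) !cb_actE addrA. Qed.

Fact cb_proj_act c g : cb_proj (cb_act c g) = cb_proj c.
Proof. by rewrite -(chart_repK c) cb_actE !cb_projE. Qed.

Fact cb_divK c d : cb_proj c = cb_proj d -> cb_act c (cb_div c d) = d.
Proof.
rewrite -(chart_repK c) -(chart_repK d) !cb_projE => e; rewrite cb_divE// cb_actE.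
by apply/gluedP; split=> //=; rewrite addrC subrK.
Qed.

Fact cb_div_act c g : cb_div c (cb_act c g) = g.
Proof.
by rewrite -(chart_repK c) cb_actE cb_divE//= cocycle2_refl add0r addrC addKr.
Qed.

Fact cb_proj_smooth : smooth cb_proj.
Proof.
move=> D p pp; apply: plot_local; apply: elocally_mono pp => E i [l pl lE].
have -> : cb_proj \o p \o i = @ev _ _ Q \o (fun u => (l u).1).
  by rewrite -compA lE; apply/funext => u /=; rewrite cb_projE.
exact: (ev_smooth pl.1).
Qed.

Fact cb_act_smooth : smooth (fun w : total * G => cb_act w.1 w.2).
Proof.
move=> D p [pc pg]; apply: plot_local.
have := elocally_and (@quot_stable _ _ _ _ _) (@estable_plot _ _ _ _)
  pc (plot_elocallyP pg).
apply: elocally_mono => E i [[l pl lE] pgi].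
have -> : (fun w : total * G => cb_act w.1 w.2) \o p \o i =
    qclass glued \o (fun u => ((l u).1, (l u).2 + (p (i u)).2)).
  by apply/funext => u /=; have /= -> := congr1 (@^~ u) lE; rewrite cb_actE.
apply: smooth_qclass; split; first exact: pl.1.
exact: (plotD pl.2 pgi).
Qed.

Fact cb_div_plot (D : edom R) (p q : D -> total) : plot p -> plot q ->
  (forall u, cb_proj (p u) = cb_proj (q u)) -> plot (fun u => cb_div (p u) (q u)).
Proof.
move=> pp pq e; apply: plot_local.
have := elocally_and (@quot_stable _ _ _ _ _) (@quot_stable _ _ _ _ _) pp pq.
apply: elocally_mono => E i [[l pl lE] [m pm mE]].
have pE u : p (i u) = qclass glued (l u) by have /= := congr1 (@^~ u) lE.
have qE u : q (i u) = qclass glued (m u) by have /= := congr1 (@^~ u) mE.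
have lm u : ev (l u).1 = ev (m u).1 by rewrite -!cb_projE -pE -qE.
have -> : (fun u => cb_div (p u) (q u)) \o i =
    fun u => cocycle2 z (l u).1 (m u).1 + (m u).2 - (l u).2.
  by apply/funext => u /=; rewrite pE qE cb_divE.
apply: (plotD (f := fun u => _ + _) (g := fun u => - _)); last exact: (plotN pl.2).
exact: (plotD (cocycle2_plot z pl.1 pm.1 lm) pm.2).
Qed.

Definition cb_section (a : nebula Q) : total := qclass glued (a, 0).

Fact cb_section_smooth : smooth cb_section.
Proof.
move=> D p pp; apply: (@smooth_qclass _ _ glued _ (fun u => (p u, 0))).
by split=> //; apply: plot_cst.
Qed.

Fact cb_section_proj a : cb_proj (cb_section a) = ev a.
Proof. exact: cb_projE. Qed.

Fact cb_proj_lift (D : edom R) (r : D -> X) : plot r ->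
  elocally (fun E (i : E -> D) =>
    exists2 l : E -> total, plot l & r \o i = cb_proj \o l).
Proof.
move=> pr; apply: elocally_mono (ev_lift Q pr) => E i [l pl lE].
exists (cb_section \o l); first exact: cb_section_smooth.
by rewrite lE; apply/funext => u /=; rewrite cb_section_proj.
Qed.

Definition cocycle_bundle : principal_bundle G X :=
  mk_bundle cb_act0 cb_actD cb_act_smooth cb_proj_act cb_proj_smooth cb_proj_lift
    cb_divK cb_div_act cb_div_plot.

Definition cocycle_lifting : lifting cocycle_bundle Q :=
  @Lifting _ cocycle_bundle Q cb_section cb_section_smooth cb_section_proj.

Lemma transition_cocycle_lifting : transition cocycle_lifting = z.
Proof.
apply: eq_cocycle2 => a b e; rewrite transitionE//.
apply: (@pb_act_inj _ cocycle_bundle (cb_section a)).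
rewrite pdivK; last exact: (lift_projE cocycle_lifting e).
by rewrite /= cb_actE add0r; apply/gluedP; split=> //=;
  rewrite cocycle2D// cocycle2_refl.
Qed.

End CocycleBundle.

Lemma bundle_cech_surj (X : diffType R) (c : cechH1 G X) :
  exists P : principal_bundle G X, bundle_cech P = c.
Proof.
have [Q [d ->]] := cech_in_surj c; have [z ->] := cech_class_surj d.
exists (cocycle_bundle z).
by rewrite (bundle_cechE (cocycle_lifting z)) transition_cocycle_lifting.
Qed.

End PrincipalBundles.

Theorem theorem5p15 (R : realType) (G : abDiffGroupType R) :
  exists Phi : forall X : diffType R, bundle_class G X -> cechH1 G X,
    (forall X : diffType R, bijective (Phi X)) /\
    (forall (X Y : diffType R) (phi : Y -> X) (sphi : smooth phi)
            (P : principal_bundle G X),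
        Phi Y (class_of_bundle (pullback_bundle sphi P)) =
        cech_map sphi (Phi X (class_of_bundle P))).
Proof.
pose Phi (X : diffType R) (c : bundle_class G X) :=
  bundle_cech (projT1 (cid (svalP c))).
have PhiE X (P : principal_bundle G X) : Phi X (class_of_bundle P) = bundle_cech P.
  rewrite /Phi; case: cid => P' /= E; apply/esym/bundle_cech_iso.
  by rewrite E; exact: bundle_iso_refl.
exists Phi; split=> [X|X Y phi sphi P]; last by rewrite !PhiE bundle_cech_pullback.
pose Psi (c : cechH1 G X) := class_of_bundle (projT1 (cid (bundle_cech_surj c))).
exists Psi => [[S [P SE]]|c]; last by rewrite /Psi PhiE; case: cid.
have -> : exist _ S (ex_intro _ P SE) = class_of_bundle P by apply: sval_inj.
rewrite /Psi PhiE; case: cid => P' /= /bundle_cech_inj.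
exact: class_of_bundle_eq.
Qed.
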